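(* MinTimeline$_\infty$ can be solved in $(k+1)^n(\ell+2)^n2^n\,\tau\, n^{O(1)}$ time, where $n=|V|$.
   Context: A temporal graph $\mathcal{G}=(V,(E_i)_{i\in[\tau]})$ consists of a finite vertex set $V$ and edge sets $E_1,\dots,E_\tau\subseteq\binom{V}{2}$. A $k$-activity timeline is a set $\mathcal{T}\subseteq\{(v,a,b)\in V\times[\tau]\times[\tau]\mid a\le b\}$ with at most $k$ triples $(v,\cdot,\cdot)$ for each $v\in V$; it covers $\mathcal{G}$ if for every $t\in[\tau]$ and $\{u,v\}\in E_t$ there is $(u,a,b)\in\mathcal{T}$ or $(v,a,b)\in\mathcal{T}$ with $a\le t\le b$. MinTimeline$_\infty$: given $(\mathcal{G},k,\ell)$ with $k,\ell\in\mathbb{N}_0$, decide whether there is a $k$-activity timeline $\mathcal{T}$ covering $\mathcal{G}$ with $\max_{(v,a,b)\in\mathcal{T}}(b-a)\le\ell$. *)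

(* Defs.v *)
From mathcomp Require Import all_boot.
Set Implicit Arguments. Unset Strict Implicit. Unset Printing Implicit Defensive.

(* Vertex set V = 'I_n.  Temporal graph with lifetime tau: the edge set *)
(* E_t (t in [1, tau]) is given by E t : 'I_n -> 'I_n -> bool, where    *)
(* {u,v} \in E_t  iff  u < v and E t u v (entries with u >= v ignored). *)

Definition edge_at (n : nat) (E : nat -> 'I_n -> 'I_n -> bool)
  (t : nat) (u v : 'I_n) : bool := (u < v) && E t u v.

(* A timeline is a finite set of triples (v, a, b); represented as a
   duplicate-free sequence. *)
Definition timeline (n : nat) := seq ('I_n * nat * nat).

Definition is_k_activity_timeline (n k tau : nat) (T : timeline n) : Prop :=
  uniq T /\
  (forall x, x \in T -> 1 <= x.1.2 /\ x.1.2 <= x.2 /\ x.2 <= tau) /\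
  (forall v : 'I_n, count (fun x => x.1.1 == v) T <= k).

Definition covers (n tau : nat) (E : nat -> 'I_n -> 'I_n -> bool)
  (T : timeline n) : Prop :=
  forall (t : nat) (u v : 'I_n), 1 <= t <= tau -> @edge_at n E t u v ->
    exists x, x \in T /\ (x.1.1 = u \/ x.1.1 = v) /\ x.1.2 <= t <= x.2.

Definition MinTimelineInf (n k l tau : nat)
  (E : nat -> 'I_n -> 'I_n -> bool) : Prop :=
  exists T : timeline n,
    @is_k_activity_timeline n k tau T /\ @covers n tau E T /\
    (forall x, x \in T -> x.2 - x.1.2 <= l).

Inductive instr : Type :=
| IConst of nat & nat
| IAdd of nat & nat & nat
| ISub of nat & nat & nat
| ILoad of nat & nat
| IStore of nat & nat
| IJz of nat & nat
| IHalt.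

Definition memory := nat -> nat.
Definition config := (nat * memory)%type.

Definition upd (m : memory) (r v : nat) : memory :=
  fun x => if x == r then v else m x.

(* One step; None when the machine halts (Halt or pc out of range). *)
Definition step (P : seq instr) (c : config) : option config :=
  let: (pc, m) := c in
  match nth IHalt P pc with
  | IHalt => None
  | IConst r k => Some (pc.+1, upd m r k)
  | IAdd r a b => Some (pc.+1, upd m r (m a + m b))
  | ISub r a b => Some (pc.+1, upd m r (m a - m b))
  | ILoad r a => Some (pc.+1, upd m r (m (m a)))
  | IStore a b => Some (pc.+1, upd m (m a) (m b))
  | IJz a j => Some (if m a == 0 then j else pc.+1, m)
  end.

Fixpoint halts_in (P : seq instr) (fuel : nat) (c : config) : option memory :=
  match step P c with
  | None => Some c.2
  | Some c' => match fuel with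
               | 0 => None
               | f.+1 => halts_in P f c'
               end
  end.

Definition init (input : seq nat) : config :=
  (0, fun x => if x == 0 then size input else nth 0 input x.-1).

Definition vpairs (n : nat) : seq ('I_n * 'I_n) :=
  flatten [seq [seq (i, j) | j : 'I_n <- enum 'I_n & (i < j)%N] | i : 'I_n <- enum 'I_n].

Definition encode (n k l tau : nat) (E : nat -> 'I_n -> 'I_n -> bool)
  : seq nat :=
  [:: n; k; l; tau] ++
  flatten [seq [seq nat_of_bool (E t p.1 p.2) | p <- vpairs n] | t <- iota 1 tau].

(* Main.v *)
Require Import Defs.
From mathcomp Require Import all_boot zify.
Set Implicit Arguments. Unset Strict Implicit. Unset Printing Implicit Defensive.

(* A vertex allowed k intervals of length l gets a budget of k(l+1) active time
   units.  At each step it is either active, which costs one unit, or idle, which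
   is allowed only when l+1 divides the remaining budget; a maximal block of
   activity between two multiples of l+1 is then one interval of length l.
   Conversely a covering timeline yields such a schedule greedily: become active
   when an interval of the timeline demands it, stay active until the budget is
   again a multiple of l+1.  If the budget is q(l+1)+r at time t, at most q
   intervals of the timeline end at time t+r or later.

   Budget vectors are encoded as numbers in base W = k(l+1)+2 <= (k+1)(l+2), and
   sets of active vertices as numbers with digits 0 and 1, so a transition is a
   subtraction.  A forward dynamic program over the tau steps, the 2^n sets and
   the W^n vectors, with O(n) work for each triple, decides reachability; digits
   are read off precomputed tables of x mod W and x div W.  The program is written
   in a small language of counted loops and arrays, compiled to the RAM. *)

(** * A language of counted loops and arrays, and its compilation *)

(* Counted loops make [eval] and [cost] total.  In [CLoop x b] the register [x]
   counts down to 0; [wf] forbids [b] to write it. *)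
Inductive com : Type :=
| CConst of nat & nat
| CAdd of nat & nat & nat
| CSub of nat & nat & nat
| CRd of nat & nat & nat
| CWr of nat & nat & nat
| CSeq of com & com
| CLoop of nat & com.

Record state := State { vr : nat -> nat; ar : nat -> nat -> nat }.

Definition setv (s : state) x v := State (upd (vr s) x v) (ar s).
Definition seta (s : state) a i v :=
  State (vr s) (fun b => if b == a then upd (ar s a) i v else ar s b).

Fixpoint eval (c : com) (s : state) : state :=
  match c with
  | CConst x k => setv s x k
  | CAdd x y z => setv s x (vr s y + vr s z)
  | CSub x y z => setv s x (vr s y - vr s z)
  | CRd x a y => setv s x (ar s a (vr s y))
  | CWr a y x => seta s a (vr s y) (vr s x)
  | CSeq c1 c2 => eval c2 (eval c1 s)
  | CLoop x b =>
      iter (vr s x) (fun s => let s' := eval b s in setv s' x (vr s' x - 1)) s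
  end.

(** The 4 counts the exit test and the three instructions that decrement the counter and jump back;
    the final 1 is the test that leaves the loop. *)
Fixpoint loop_cost (f : state -> state) (g : state -> nat) n s :=
  if n is n'.+1 then g s + 4 + loop_cost f g n' (f s) else 1.

Fixpoint cost (c : com) (s : state) : nat :=
  match c with
  | CConst _ _ | CAdd _ _ _ | CSub _ _ _ => 1
  | CRd _ _ _ | CWr _ _ _ => 7
  | CSeq c1 c2 => cost c1 s + cost c2 (eval c1 s)
  | CLoop x b =>
      loop_cost (fun s => let s' := eval b s in setv s' x (vr s' x - 1))
                (cost b) (vr s x) s
  end.

Fixpoint mods (c : com) : seq nat :=
  match c with
  | CConst x _ | CAdd x _ _ | CSub x _ _ | CRd x _ _ => [:: x]
  | CWr _ _ _ => [::]
  | CSeq c1 c2 => mods c1 ++ mods c2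
  | CLoop x b => x :: mods b
  end.

Fixpoint amods (c : com) : seq nat :=
  match c with
  | CWr a _ _ => [:: a]
  | CSeq c1 c2 => amods c1 ++ amods c2
  | CLoop _ b => amods b
  | _ => [::]
  end.

Definition num_regs := 48.
Definition isvar x := (x < num_regs) && (x \notin [:: 0; 5; 6; 7]).

Fixpoint wf (c : com) : bool :=
  match c with
  | CConst x _ => isvar x
  | CAdd x y z | CSub x y z => [&& isvar x, isvar y & isvar z]
  | CRd x a y | CWr a y x => [&& isvar x, isvar y & a < 8]
  | CSeq c1 c2 => wf c1 && wf c2
  | CLoop x b => [&& isvar x, x \notin mods b & wf b]
  end.

Fixpoint clen (c : com) : nat :=
  match c with
  | CConst _ _ | CAdd _ _ _ | CSub _ _ _ => 1
  | CRd _ _ _ | CWr _ _ _ => 7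
  | CSeq c1 c2 => clen c1 + clen c2
  | CLoop _ b => clen b + 4
  end.

(** The machine cannot multiply, so register 7 reaches 8 times the index by three doublings. The
    factor 8 interleaves eight unbounded arrays. *)
Definition address a y :=
  [:: IConst 6 a; IAdd 6 6 0; IAdd 7 y y; IAdd 7 7 7; IAdd 7 7 7; IAdd 6 6 7].

Fixpoint compile (c : com) (o : nat) : seq instr :=
  match c with
  | CConst x k => [:: IConst x k]
  | CAdd x y z => [:: IAdd x y z]
  | CSub x y z => [:: ISub x y z]
  | CRd x a y => address a y ++ [:: ILoad x 6]
  | CWr a y x => address a y ++ [:: IStore 6 x]
  | CSeq c1 c2 => compile c1 o ++ compile c2 (o + clen c1)
  | CLoop x b => IJz x (o + clen b + 4) :: compile b o.+1 ++
                 [:: IConst 7 1; ISub x x 7; IJz 5 o]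
  end.

Lemma size_compile c o : size (compile c o) = clen c.
Proof.
elim: c o => //= [c1 IH1 c2 IH2|x b IH] o; first by rewrite size_cat IH1 IH2.
by rewrite size_cat IH /= addn3 addn4.
Qed.

(** * Correctness of the compiler *)

Fixpoint runs (P : seq instr) t (c c' : config) : Prop :=
  if t is t'.+1 then
    if step P c is Some c1 then runs P t' c1 c' else False
  else c = c'.

Lemma runs_trans P t1 t2 c1 c2 c3 :
  runs P t1 c1 c2 -> runs P t2 c2 c3 -> runs P (t1 + t2) c1 c3.
Proof.
elim: t1 c1 => [|t1 IH] c1 /=; first by move=> ->.
by case: (step P c1) => [c|] // H1 H2; exact: IH H1 H2.
Qed.

Lemma runs_halts P t fuel c pc m : runs P t c (pc, m) ->
  nth IHalt P pc = IHalt -> t <= fuel -> halts_in P fuel c = Some m.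
Proof.
move=> + H; elim: t fuel c => [|t IH] fuel c /=.
  by move=> -> _; case: fuel => [|f] /=; rewrite H.
by case: fuel => [|f] //=; case: (step P c) => // c1 ? ?; apply: IH.
Qed.

Definition code_at (P : seq instr) o cs :=
  forall i, i < size cs -> nth IHalt P (o + i) = nth IHalt cs i.

Lemma code_at_cat P o c1 c2 :
  code_at P o (c1 ++ c2) -> code_at P o c1 /\ code_at P (o + size c1) c2.
Proof.
move=> H; split=> i Hi.
  by rewrite H ?nth_cat ?Hi // size_cat; lia.
rewrite -addnA H ?size_cat ?ltn_add2l // nth_cat ltnNge leq_addr /=.
by rewrite addKn.
Qed.

Lemma code_at_self P1 P2 P3 : code_at (P1 ++ P2 ++ P3) (size P1) P2.
Proof.
move=> i Hi; rewrite nth_cat ltnNge leq_addr /= addKn nth_cat Hi //.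
Qed.

(* Registers 0, 5, 6 and 7 hold the array base, the constant 0 (for unconditional
   jumps) and two scratch values; cell [i] of array [a] is at address B + 8i + a. *)
Record sim (B : nat) (s : state) (m : memory) : Prop := Sim {
  sim_base : m 0 = B;
  sim_zero : m 5 = 0;
  sim_large : num_regs <= B;
  sim_var : forall x, isvar x -> m x = vr s x;
  sim_arr : forall a i, a < 8 -> m (B + 8 * i + a) = ar s a i }.

Lemma isvarP x : isvar x -> x < num_regs /\ x <> 0 /\ x <> 5 /\ x <> 6 /\ x <> 7.
Proof. by rewrite /isvar !inE => /andP[]; lia. Qed.

Lemma sim_tmp B s m x v : sim B s m -> x \in [:: 6; 7] -> sim B s (upd m x v).
Proof.
move=> [h1 h2 h3 h4 h5]; rewrite !inE => Hx; have Hx' : 5 < x < 8 by lia.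
split=> //; rewrite /upd.
- by case: eqP => //; lia.
- by case: eqP => //; lia.
- by move=> y Hy; case: eqP => [|_]; [move/isvarP: Hy; lia|exact: h4].
- move=> a i Ha; case: eqP => [|_]; last exact: h5.
  by move: h3; rewrite /num_regs; lia.
Qed.

Lemma sim_setv B s m x v : sim B s m -> isvar x -> sim B (setv s x v) (upd m x v).
Proof.
move=> [h1 h2 h3 h4 h5] /isvarP Hx.
split=> //; rewrite /upd.
- by case: eqP => //; lia.
- by case: eqP => //; lia.
- by move=> y Hy /=; rewrite /upd; case: eqP => // _; exact: h4.
- move=> a i Ha; case: eqP => [|_]; last exact: h5.
  by lia.
Qed.

Lemma sim_seta B s m a i v : sim B s m -> a < 8 ->
  sim B (seta s a i v) (upd m (B + 8 * i + a) v).
Proof.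
move=> [h1 h2 h3 h4 h5] Ha; move: (h3); rewrite /num_regs => h3'.
split=> //; rewrite /upd.
- by case: eqP => //; lia.
- by case: eqP => //; lia.
- by move=> y Hy /=; case: eqP => [|_]; [move/isvarP: Hy; lia|exact: h4].
- move=> b j Hb /=; case: (b =P a) => [->|ne].
    rewrite /upd; case: (j =P i) => [->|ne']; first by rewrite eqxx.
    by case: eqP => [|_]; [lia | exact: h5].
  by case: eqP => [|_]; [lia | exact: h5].
Qed.

Lemma run_address P o a y cs B s m : code_at P o (address a y ++ cs) ->
  sim B s m -> isvar y -> a < 8 ->
  exists2 m', runs P 6 (o, m) (o + 6, m') &
    sim B s m' /\ m' 6 = B + 8 * vr s y + a.
Proof.
move=> H S Hy Ha.
have N i : i < 6 -> nth IHalt P (o + i) = nth IHalt (address a y) i.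
  by move=> Hi; rewrite H ?nth_cat ?size_cat /= ?Hi //; lia.
have := N 0; have := N 1; have := N 2; have := N 3; have := N 4; have := N 5.
rewrite !addnS addn0 /=.
do 6 move/(_ isT) => ?.
do 6 (rewrite /=; match goal with H : nth _ _ _ = _ |- _ => rewrite H; clear H end).
eexists; first by [].
split; first by do 6 (apply: sim_tmp => //).
have [h1 h2 h3 h4 h5] := S; have := isvarP Hy => ?.
rewrite /upd /= h1 (h4 _ Hy).
have -> : (y == 6) = false by lia.
by rewrite ?(h4 _ Hy); lia.
Qed.

Lemma eval_frame c s x : x \notin mods c -> vr (eval c s) x = vr s x.
Proof.
elim: c s => [y k|y z w|y z w|y a z|a y z|c1 IH1 c2 IH2|y b IH] s //=;
  rewrite ?inE ?mem_cat ?negb_or; try by rewrite /upd => /negbTE ->.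
  by move=> /andP[H1 H2]; rewrite IH2 // IH1.
move=> /andP[H1 H2]; elim: (vr s y) => //= n IHn.
by rewrite /upd (negbTE H1) IH.
Qed.

Lemma eval_aframe c s a i : a \notin amods c -> ar (eval c s) a i = ar s a i.
Proof.
elim: c s => [y k|y z w|y z w|y b z|b y z|c1 IH1 c2 IH2|y b IH] s //=;
  rewrite ?inE ?mem_cat ?negb_or; try by move=> /negbTE ->.
  by move=> /andP[H1 H2]; rewrite IH2 // IH1.
by move=> H; elim: (vr s y) => //= n IHn; rewrite IH.
Qed.

(** The step count is exact, so any bound on [cost] becomes a bound on the running time of the
    machine. *)
Lemma compile_correct P c o B s m : wf c -> code_at P o (compile c o) -> sim B s m ->
  exists2 m', runs P (cost c s) (o, m) (o + clen c, m') & sim B (eval c s) m'.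
Proof.
elim: c o s m => [x k|x y z|x y z|x a y|a y x|c1 IH1 c2 IH2|x b IH] o s m /=.
- move=> Hx H S; have := H 0 isT; rewrite addn0 addn1 /= => ->.
  by eexists; [done|exact: sim_setv].
- move=> /and3P[Hx Hy Hz] H S; have := H 0 isT; rewrite addn0 addn1 /= => ->.
  by eexists; [done|rewrite !(sim_var S) //; exact: sim_setv].
- move=> /and3P[Hx Hy Hz] H S; have := H 0 isT; rewrite addn0 addn1 /= => ->.
  by eexists; [done|rewrite !(sim_var S) //; exact: sim_setv].
- move=> /and3P[Hx Hy Ha] H S; have [m1 R1 [S1 E1]] := run_address H S Hy Ha.
  have := H 6 isT => /= E.
  exists (upd m1 x (m1 (m1 6))).
    by apply: (runs_trans (t1 := 6) (t2 := 1) R1); rewrite /= E !addnS.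
  by rewrite E1 (sim_arr S1) //; exact: sim_setv.
- move=> /and3P[Hx Hy Ha] H S; have [m1 R1 [S1 E1]] := run_address H S Hy Ha.
  have := H 6 isT => /= E.
  exists (upd m1 (m1 6) (m1 x)).
    by apply: (runs_trans (t1 := 6) (t2 := 1) R1); rewrite /= E !addnS.
  by rewrite E1 (sim_var S1) //; exact: sim_seta.
- move=> /andP[W1 W2] /code_at_cat[H1 H2] S; rewrite size_compile in H2.
  have [m1 R1 S1] := IH1 _ _ _ W1 H1 S; have [m2 R2 S2] := IH2 _ _ _ W2 H2 S1.
  by exists m2 => //; apply: runs_trans R1 _; rewrite addnA.
- move=> /and3P[Hx Hn Wb] H S.
  have := H 0 isT; rewrite addn0 /= => E0.
  have [_] := @code_at_cat P o [:: _] _ H; rewrite addn1 => /code_at_cat[Hb Ht].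
  rewrite size_compile in Ht.
  have := Ht 0 isT; have := Ht 1 isT; have := Ht 2 isT.
  rewrite addn0 addn1 addn2 /= => T2 T1 T0 {H Ht}.
  (* Induction on the counter. By [wf] the body does not write [x], which therefore still holds
     [n.+1] when the decrement is reached; loading 1 into register 7 is invisible to [sim]. *)
  move E: (vr s x) => n; elim: n s m S E => [|n IHn] s m S E.
    exists m => //=; rewrite E0 (sim_var S) // E /=; congr (_, _); lia.
  have [m1 R1 S1] := IH _ _ _ Wb Hb S.
  have Ex : vr (eval b s) x = n.+1 by rewrite eval_frame.
  pose f s := setv (eval b s) x (vr (eval b s) x - 1); rewrite iterSr -/f.
  have S2 : sim B (f s) (upd (upd m1 7 1) x (n.+1 - 1)).
    rewrite /f /= Ex; apply: sim_setv => //; exact: sim_tmp.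
  have Ef : vr (f s) x = n by rewrite /f /= /upd eqxx Ex subn1.
  have [m2 R2 S3] := IHn _ _ S2 Ef.
  exists m2 => //=; rewrite -/f.
  have -> : cost b s + 4 + loop_cost f (cost b) n (f s) =
    (1 + (cost b s + (3 + loop_cost f (cost b) n (f s)))) by lia.
  rewrite /= E0 (sim_var S) // E /=.
  apply: runs_trans R1 _.
  have -> : o.+1 + clen b = (o + clen b).+1 by lia.
  rewrite /= in T0 T1 T2.
  have /isvarP Hx' := Hx.
  rewrite addSn in T0 T1 T2; rewrite /= T0 /= T1 /= T2 /= /upd /=.
  have -> : (5 == x) = false by lia.
  have -> : (x == 7) = false by lia.
  by rewrite (sim_zero S1) /= (sim_var S1) // Ex.
Qed.

(** * Relocating the input *)

(* The input lies in the cells that serve as registers, and at the start no register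
   is free.  Array 0 is filled from the input; with base 16 * size (at least 64) all
   arrays lie beyond the input, so the other ones are initially zero.  Register 5
   is saved first and then holds the stride 8. *)
Definition save_cell r := [:: IAdd 0 0 5; IStore 0 r].

Definition save_cells r j := flatten [seq save_cell x | x <- iota r j].

Definition copy_loop o :=
  [:: IJz 10 (o + 8); IAdd 0 0 5; ILoad 11 8; IStore 0 11; IAdd 8 8 9;
      ISub 10 10 9; IConst 6 0; IJz 6 o].

(* The loop also copies the zero cells between the end of the input and the base,
   since the input size is no longer in a register.  95 is the address of the loop. *)
Definition prologue :=
  [:: IAdd 0 0 0; IAdd 0 0 0; IAdd 0 0 0; IAdd 0 0 0; IStore 0 5; IConst 5 8] ++
  (save_cells 6 42 ++
  ([:: IConst 6 336; ISub 7 0 6; IConst 8 48; IConst 9 1; ISub 10 7 8] ++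
  (copy_loop 95 ++ [:: IConst 5 0; IAdd 0 7 5]))).

(* The first [j.+1] input bits have been moved to every eighth cell from [B] on. *)
Record moved (B j : nat) (m0 m : memory) : Prop := Moved {
  mv_ptr : m 0 = B + 8 * j;
  mv_8 : m 5 = 8;
  mv_head : forall x, 0 < x < 5 -> m x = m0 x;
  mv_tail : forall x, 48 <= x < B -> m x = m0 x;
  mv_arr : forall y, m (B + y) =
    if (8 %| y) && (y %/ 8 <= j) then m0 (5 + y %/ 8) else 0 }.

Lemma moved_write B j m0 m v : 48 <= B -> moved B j m0 m -> v = m0 (5 + j.+1) ->
  moved B j.+1 m0
    (upd (upd m 0 (B + 8 * j.+1)) (B + 8 * j.+1) v).
Proof.
move=> HB [h1 h2 h3 h4 h5] ->; split; rewrite /upd.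
- by case: eqP => //; lia.
- by case: eqP => [|_] //=; lia.
- by move=> x Hx; case: eqP => [|_] //=; first lia; case: eqP => [|_]; [lia|exact: h3].
- by move=> x Hx; case: eqP => [|_] //=; first lia; case: eqP => [|_]; [lia|exact: h4].
- move=> y; case: (B + y =P _) => [e|ne].
    have -> : y = j.+1 * 8 by lia.
    by rewrite dvdn_mull // mulnK // leqnn.
  have -> : (B + y == 0) = false by lia.
  rewrite h5; case: (boolP (8 %| y)) => //= Hd.
  have := divnK Hd => E.
  have -> : (y %/ 8 <= j.+1) = (y %/ 8 <= j) by lia.
  by [].
Qed.

Lemma size_save_cells r j : size (save_cells r j) = 2 * j.
Proof. by elim: j r => //= j IH r; rewrite -/(save_cells r.+1 j) IH; lia. Qed.

(** Saving uses only the pointer in register 0 and the stride in register 5, and it writes beyond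
    [B], so the cells not yet saved are still intact. *)
Lemma save_cells_correct P B m0 j i o m : 48 <= B -> i + j <= 42 ->
  code_at P o (save_cells (6 + i) j) -> moved B i m0 m ->
  (forall x, 6 + i <= x < 48 -> m x = m0 x) ->
  exists2 m', runs P (2 * j) (o, m) (o + 2 * j, m') & moved B (i + j) m0 m'.
Proof.
move=> HB; elim: j i o m => [|j IH] i o m Hij H M Hm.
  by exists m; rewrite ?muln0 /= ?addn0.
have [H1 H2] := @code_at_cat P o (save_cell (6 + i)) (save_cells (7 + i) j) H.
have E0 := H1 0 isT; have E1 := H1 1 isT.
rewrite addn0 /= in E0; rewrite addn1 /= in E1.
set m1 := upd (upd m 0 (B + 8 * i.+1)) (B + 8 * i.+1) (m0 (5 + i.+1)).
have M1 : moved B i.+1 m0 m1 by exact: moved_write.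
have [|x Hx|m2 R2 M2] := IH i.+1 _ _ _ H2 M1; first by lia.
  rewrite /m1 /upd; case: eqP => [|_]; first lia.
  by case: eqP => [|_]; [lia|apply: Hm; lia].
exists m2; last by rewrite addnS.
have -> : 2 * j.+1 = 2 + 2 * j by lia.
rewrite addnA; apply: runs_trans R2; rewrite /= E0 /= E1 /= /upd /=.
rewrite (mv_ptr M) (mv_8 M); have -> : B + 8 * i + 8 = B + 8 * i.+1 by lia.
by rewrite Hm; [rewrite /m1 -addn2|lia].
Qed.

Lemma copy_loop_correct P B m0 c o m j : 48 <= B -> 
  code_at P o (copy_loop o) -> moved B j m0 m -> 
  m 7 = B -> m 8 = 6 + j -> m 9 = 1 -> m 10 = c -> 48 <= 6 + j -> 6 + j + c = B ->
  exists2 m', runs P (8 * c).+1 (o, m) (o + 8, m') &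
    moved B (j + c) m0 m' /\ m' 7 = B.
Proof.
move=> HB H.
have N i : i < 8 -> nth IHalt P (o + i) = nth IHalt (copy_loop o) i by exact: H.
have := N 0; have := N 1; have := N 2; have := N 3; have := N 4; have := N 5.
have := N 6; have := N 7; rewrite !addnS addn0 /=.
move=> /(_ isT) E7 /(_ isT) E6 /(_ isT) E5 /(_ isT) E4.
move=> /(_ isT) E3 /(_ isT) E2 /(_ isT) E1 /(_ isT) E0 {N H}.
elim: c j m => [|c IH] j m M h7 h8 h9 h10 hj hc.
  by exists m; rewrite ?addn0 //= E0 h10 /= !addnS addn0.
pose v := m0 (6 + j).
pose m1 := upd (upd m 0 (B + 8 * j.+1)) 11 v.
pose m2 := upd m1 (B + 8 * j.+1) v.
pose m3 := upd (upd (upd m2 8 (6 + j.+1)) 10 c) 6 0.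
have M3 : moved B j.+1 m0 m3.
  have [] := @moved_write B j m0 m v HB M _; first by rewrite /v -addSnnS.
  (* [moved] says nothing about registers 6 to 47, so the loop may use 6, 8, 10 and 11 as
     scratch. *)
  move=> a1 a2 a3 a4 a5; split; rewrite /m3 /m2 /m1 /upd /=.
  - have -> : (0 == B + 8 * j.+1) = false by lia.
    by [].
  - have -> : (5 == B + 8 * j.+1) = false by lia.
    exact: (mv_8 M).
  - move=> x Hx; rewrite -(mv_head M) //.
    by do !(case: eqP => [|_]; first lia).
  - move=> x Hx; rewrite -(mv_tail M) //.
    by do !(case: eqP => [|_]; first lia).
  - move=> y; rewrite -a5 /upd.
    have -> : (B + y == 6) = false by lia.
    have -> : (B + y == 10) = false by lia.
    have -> : (B + y == 8) = false by lia.
    by have -> : (B + y == 11) = false by lia.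
have [g7 [g8 [g9 g10]]] : m3 7 = B /\ m3 8 = 6 + j.+1 /\ m3 9 = 1 /\ m3 10 = c.
  rewrite /m3 /m2 /m1 /upd /=.
  have -> : (7 == B + 8 * j.+1) = false by lia.
  by have -> : (9 == B + 8 * j.+1) = false by lia.
have [||m' R [M' H7]] := IH j.+1 m3 M3 g7 g8 g9 g10; [lia|lia|].
exists m'; last by rewrite addnS -addSn.
rewrite -/(runs P (8 * c.+1).+1 (o, m) _).
have -> : (8 * c.+1).+1 = 8 + (8 * c).+1 by lia.
apply: (@runs_trans P 8 (8 * c).+1 _ (o, m3)) R.
rewrite /= E0 h10 /= E1 /= E2 /= E3 /= E4 /= E5 /= E6 /= E7 /=.
congr (_, _); rewrite /m3 /m2 /m1.
rewrite /upd /=.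
rewrite (mv_ptr M) (mv_8 M) h8.
have -> : B + 8 * j + 8 = B + 8 * j.+1 by lia.
have -> : (6 + j == 0) = false by lia.
rewrite (mv_tail M); last lia.
have -> : (8 == B + 8 * j.+1) = false by lia.
have -> : (9 == B + 8 * j.+1) = false by lia.
have -> : (10 == B + 8 * j.+1) = false by lia.
by rewrite h9 h10 subn1 addn1.
Qed.

Lemma prologue_correct P n k l tau bits :
  code_at P 0 prologue ->
  exists t m B, runs P t (init [:: n, k, l, tau & bits]) (105, m) /\
    t <= 128 * (size bits).+4 /\
    exists2 s, sim B s m &
      [/\ vr s 1 = n, vr s 2 = k, vr s 3 = l & vr s 4 = tau] /\
      (forall i, ar s 0 i = nth 0 bits i) /\
      (forall a i, 0 < a < 8 -> ar s a i = 0).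
Proof.
rewrite /prologue => /code_at_cat[H1] /code_at_cat[H2] /code_at_cat[H3].
move=> /code_at_cat[H4 H5].
rewrite size_save_cells /= in H2 H3 H4 H5.
rewrite /init; set m0 := (X in (0, X)).
set B := 16 * (size bits).+4.
have HB : 64 <= B by rewrite /B; lia.
have HB' : 48 <= B by lia.
have m00 : m0 0 = (size bits).+4 by [].
(* The input occupies cells 1 to [(size bits).+4], far below [B]. *)
have m0big x : B <= x.+1 -> m0 x = 0.
  rewrite /m0 /B => Hx; case: eqP => [|_]; first lia.
  by rewrite nth_default //=; lia.
have [m1 R1 [M1 K1]] : exists2 m1, runs P 6 (0, m0) (6, m1) & moved B 0 m0 m1 /\
    (forall x, 6 <= x < 48 -> m1 x = m0 x).
  have := H1 0 isT; have := H1 1 isT; have := H1 2 isT; have := H1 3 isT.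
  have := H1 4 isT; have := H1 5 isT; rewrite !add0n /=.
  move=> E5 E4 E3 E2 E1 E0; rewrite E0 /= E1 /= E2 /= E3 /= E4 /= E5 /=.
  eexists; first by [].
  rewrite /upd /=.
  have e : m0 0 + m0 0 + (m0 0 + m0 0) + (m0 0 + m0 0 + (m0 0 + m0 0)) +
    (m0 0 + m0 0 + (m0 0 + m0 0) + (m0 0 + m0 0 + (m0 0 + m0 0))) = B.
    by rewrite m00 /B; lia.
  rewrite e; split; first split.
  - have -> : (0 == B) = false by lia.
    by rewrite /= muln0 addn0.
  - by [].
  - by move=> x Hx; do !(case: eqP => [|_]; first lia).
  - by move=> x Hx; do !(case: eqP => [|_]; first lia).
  - move=> y; have -> : (B + y == 5) = false by lia.
    case: eqP => [ey|ne]; first by have -> : y = 0 by lia.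
    have -> : (B + y == 0) = false by lia.
    rewrite m0big; last lia.
    case: (boolP (8 %| y)) => //= Hd; have := divnK Hd => E.
    by have -> : (y %/ 8 <= 0) = false by lia.
  - by move=> x Hx; do !(case: eqP => [|_]; first lia).
have [m2 R2 M2] := @save_cells_correct P B m0 42 0 6 m1 HB' isT H2 M1 K1.
(* The 42 saved cells have advanced the pointer by 8 * 42 = 336; subtracting this recovers [B].
   Cells 48 to [B - 1] remain to be copied, hence the count [B - 48]. *)
have [m3 R3 [M3 K3]] : exists2 m3, runs P 5 (90, m2) (95, m3) &
    moved B 42 m0 m3 /\
    [/\ m3 7 = B, m3 8 = 48, m3 9 = 1 & m3 10 = B - 48].
  have := H3 0 isT; have := H3 1 isT; have := H3 2 isT; have := H3 3 isT.
  have := H3 4 isT; rewrite /=.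
  move=> E4 E3 E2 E1 E0; rewrite E0 /= E1 /= E2 /= E3 /= E4 /=.
  eexists; first by [].
  rewrite /upd /= (mv_ptr M2); have -> : B + 8 * 42 - 336 = B by lia.
  split=> //; split=> /=.
  - exact: mv_ptr M2.
  - exact: mv_8 M2.
  - by move=> x Hx; rewrite -(mv_head M2) //; do !(case: eqP => [|_]; first lia).
  - by move=> x Hx; rewrite -(mv_tail M2) //; do !(case: eqP => [|_]; first lia).
  - by move=> y; rewrite -(mv_arr M2) //; do !(case: eqP => [|_]; first lia).
case: K3 => k7 k8 k9 k10.
have Hc : 6 + 42 + (B - 48) = B by lia.
have [m4 R4 [M4 k7']] := copy_loop_correct HB' H4 M3 k7 k8 k9 k10 isT Hc.
pose m5 := upd (upd m4 5 0) 0 B.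
have R5 : runs P 2 (103, m4) (105, m5).
  have := H5 0 isT; have := H5 1 isT; rewrite /= => E1 E0.
  by rewrite E0 /= E1 /= /m5 /upd /= k7' addn0.
exists (6 + (84 + (5 + ((8 * (B - 48)).+1 + 2)))), m5, B; split.
  apply: runs_trans R1 _; apply: runs_trans R2 _; apply: runs_trans R3 _.
  exact: runs_trans R4 R5.
split; first by rewrite /B; lia.
exists (State m5 (fun a i => m5 (B + 8 * i + a))).
  split=> //; rewrite /m5 /upd //=.
have arr a i : m5 (B + 8 * i + a) = m4 (B + (8 * i + a)).
  rewrite /m5 /upd -addnA; case: eqP => [|_]; first lia.
  by case: eqP => [|_]; first lia.
split.
  by split; rewrite /m5 /upd /= (mv_head M4).
split=> [i|a i Ha]; rewrite /= arr (mv_arr M4).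
  rewrite addn0 dvdn_mulr // mulKn //.
  (* An index past the copied range is also past the end of [bits], where the default of [nth]
     agrees with the zero in memory. *)
  case: leqP => Hi; first by [].
  rewrite nth_default //; move: Hi Hc; rewrite /B; lia.
have -> // : (8 %| 8 * i + a) = false.
rewrite dvdn_addr ?dvdn_mulr //.
by apply/negP => /dvdn_leq; lia.
Qed.

(** * Digits *)

Definition enc W n (d : nat -> nat) := \sum_(v < n) d v * W ^ v.
Definition dig W v s := s %/ W ^ v %% W.

Lemma enc_recr W n d : enc W n.+1 d = enc W n d + d n * W ^ n.
Proof. by rewrite /enc big_ord_recr. Qed.

Lemma enc_recl W n d : enc W n.+1 d = d 0 + W * enc W n (fun v => d v.+1).
Proof.
rewrite /enc big_ord_recl expn0 muln1 big_distrr /=; congr (_ + _).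
by apply: eq_bigr => i _; rewrite expnS mulnCA.
Qed.

Lemma eq_enc W n d d' : (forall v, v < n -> d v = d' v) -> enc W n d = enc W n d'.
Proof. by move=> H; apply: eq_bigr => i _; rewrite H. Qed.

Lemma enc_lt W n d : (forall v, v < n -> d v < W) -> enc W n d < W ^ n.
Proof.
elim: n => [|n IH] H; first by rewrite /enc big_ord0.
rewrite enc_recr expnSr.
have := IH (fun v hv => H v (ltnW hv)); have := H n (ltnSn n); nia.
Qed.

Lemma dig_enc W n d v : (forall v, v < n -> d v < W) -> v < n ->
  dig W v (enc W n d) = d v.
Proof.
elim: n d v => // n IH d v H Hv; have W0 : 0 < W by apply: leq_ltn_trans (H 0 _).
rewrite enc_recl /dig; case: v Hv => [|v] Hv.
  by rewrite expn0 divn1 mulnC addnC modnMDl modn_small // H.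
rewrite expnS divnMA mulnC addnC divnMDl // (divn_small (H 0 _)) // addn0.
by apply: IH => // u Hu; apply: H.
Qed.

Lemma enc_dig W n s : s < W ^ n -> enc W n (fun v => dig W v s) = s.
Proof.
elim: n s => [|n IH] s; first by rewrite /enc big_ord0; case: s.
case: W IH => [|W] IH; first by rewrite exp0n.
rewrite enc_recl /dig expn0 divn1 => Hs.
rewrite (@eq_enc _ _ _ (fun v => dig W.+1 v (s %/ W.+1))); last first.
  by move=> v _; rewrite /dig expnS divnMA.
rewrite IH; first by rewrite addnC mulnC -divn_eq.
by rewrite ltn_divLR // -expnSr.
Qed.

(** No digit borrows. This lets the program update all [n] budgets by a single subtraction. *)
Lemma enc_sub W n d b : (forall v, v < n -> b v <= d v) ->
  enc W n d - enc W n b = enc W n (fun v => d v - b v).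
Proof.
move=> H; rewrite /enc -sumnB => [|i _]; last by rewrite leq_mul2r H ?orbT.
by apply: eq_bigr => i _; rewrite mulnBl.
Qed.

Lemma divn_expS W x i : x %/ W ^ i %/ W = x %/ W ^ i.+1.
Proof. by rewrite -divnMA -expnSr. Qed.

(** * Hoare triples with running time *)

(** The precondition is one fixed start state, so facts about initial values are ordinary
    hypotheses. Termination is built in, since [eval] is total. *)
Definition ht (c : com) (s : state) T (Q : state -> Prop) :=
  cost c s <= T /\ Q (eval c s).

Definition frame (c : com) (s s' : state) :=
  (forall y, y \notin mods c -> vr s' y = vr s y) /\
  (forall a i, a \notin amods c -> ar s' a i = ar s a i).

Lemma frame_eval c s : frame c s (eval c s).
Proof. by split=> *; [exact: eval_frame|exact: eval_aframe]. Qed.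

Lemma ht_seq c1 c2 s T1 T2 T (Q1 Q : state -> Prop) : ht c1 s T1 Q1 ->
  (forall s', Q1 s' -> frame c1 s s' -> ht c2 s' T2 Q) -> T1 + T2 <= T ->
  ht (CSeq c1 c2) s T Q.
Proof.
move=> [H1 HQ1] H2 HT; have [H3 H4] := H2 _ HQ1 (frame_eval c1 s).
by split=> //=; apply: leq_trans HT; exact: leq_add.
Qed.

(** Rule for straight-line code: the intermediate state remains a term [eval c1 s] that
    simplification computes, so no intermediate assertion has to be given. *)
Lemma ht_step c1 c2 s T t (Q : state -> Prop) : cost c1 s = t -> t <= T ->
  ht c2 (eval c1 s) (T - t) Q -> ht (CSeq c1 c2) s T Q.
Proof. by move=> Et HT [H1 H2]; split=> //=; rewrite Et; lia. Qed.

Lemma ht_last c1 s T (Q : state -> Prop) : cost c1 s <= T ->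
  Q (eval c1 s) -> ht c1 s T Q.
Proof. by []. Qed.

Lemma ht_weak c s T T' (Q Q' : state -> Prop) : ht c s T Q -> T <= T' ->
  (forall s', Q s' -> frame c s s' -> Q' s') -> ht c s T' Q'.
Proof.
move=> [H1 H2] HT H; split; first exact: leq_trans HT.
exact: H (frame_eval c s).
Qed.

(** The invariant is indexed by the number of completed iterations and restored after the decrement,
    whence the [setv]. The frame refers to the state before the loop, so values that the body leaves
    alone stay out of the invariant. *)
Lemma ht_loop x b s n (I : nat -> state -> Prop) T :
  vr s x = n -> x \notin mods b -> I 0 s ->
  (forall i s', i < n -> frame (CLoop x b) s s' -> vr s' x = n - i ->
     I i s' -> ht b s' T (fun s'' => I i.+1 (setv s'' x (n - i.+1)))) ->
  ht (CLoop x b) s (n * (T + 4) + 1) (I n).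
Proof.
move=> En Hx I0 Hstep; rewrite /ht /= En.
set f := fun s => _.
suff H j i s' : i + j = n -> frame (CLoop x b) s s' -> vr s' x = n - i -> I i s' ->
    loop_cost f (cost b) j s' <= j * (T + 4) + 1 /\ I n (iter j f s').
  by apply: (H n 0) => //; rewrite ?En ?subn0.
elim: j i s' => [|j IH] i s' Hij F Ex Ii /=.
  by rewrite addn0 in Hij; rewrite -Hij.
have Hi : i < n by lia.
have [H1 H2] := Hstep i s' Hi F Ex Ii.
have Ex' : vr (eval b s') x = n - i by rewrite eval_frame.
have Ef : f s' = setv (eval b s') x (n - i.+1) by rewrite /f Ex' -subnDA addn1.
have F' : frame (CLoop x b) s (f s').
  case: F => F1 F2; split=> [y Hy|a m Ha]; rewrite Ef /=.
    move: (Hy); rewrite inE negb_or => /andP[/negbTE Hy1 Hy2].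
    by rewrite /upd Hy1 eval_frame // F1.
  by rewrite eval_aframe // F2.
have Ex2 : vr (f s') x = n - i.+1 by rewrite Ef /= /upd eqxx.
rewrite -Ef in H2.
have [|H3 H4] := IH i.+1 (f s') _ F' Ex2 H2; first by rewrite -Hij addnS.
split; first by rewrite mulSn; lia.
by rewrite -iterS iterSr.
Qed.

(** * The dynamic program *)

Local Notation rn := 1 (only parsing).
Local Notation rk := 2 (only parsing).
Local Notation rl := 3 (only parsing).
Local Notation rtau := 4 (only parsing).
Local Notation rzero := 8 (only parsing).
Local Notation rone := 9 (only parsing).
Local Notation rf := 10 (only parsing).
Local Notation rl1 := 11 (only parsing).
Local Notation rK := 12 (only parsing).
Local Notation rc := 13 (only parsing).
Local Notation rW := 14 (only parsing).
Local Notation rw := 15 (only parsing).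
Local Notation rlen := 16 (only parsing).
Local Notation rtop := 17 (only parsing).
Local Notation rc0 := 18 (only parsing).
Local Notation ri := 19 (only parsing).
Local Notation rj := 20 (only parsing).
Local Notation rc1 := 21 (only parsing).
Local Notation rq := 22 (only parsing).
Local Notation racc := 23 (only parsing).
Local Notation rc2 := 24 (only parsing).
Local Notation rx := 25 (only parsing).
Local Notation rr := 26 (only parsing).
Local Notation rct := 27 (only parsing).
Local Notation rres := 28 (only parsing).
Local Notation rcur := 29 (only parsing).
Local Notation rnxt := 30 (only parsing).
Local Notation rpi := 31 (only parsing).
Local Notation rp := 32 (only parsing).
Local Notation rok := 33 (only parsing).
Local Notation re := 34 (only parsing).
Local Notation rci := 35 (only parsing).
Local Notation rbi := 36 (only parsing).
Local Notation ry := 37 (only parsing).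
Local Notation rcj := 38 (only parsing).
Local Notation rbj := 39 (only parsing).
Local Notation rs := 40 (only parsing).
Local Notation ro := 41 (only parsing).
Local Notation rcv := 42 (only parsing).
Local Notation rd := 43 (only parsing).
Local Notation rb := 44 (only parsing).
Local Notation rg := 45 (only parsing).
Local Notation ra := 46 (only parsing).
Local Notation reptr := 47 (only parsing).

(* Arrays: edge bits of the input, budgets at which idling is allowed, codes of the
   vertex sets, x mod W, x div W, and the number of ways to reach each pair
   (step, budget vector). *)
Local Notation aE := 0 (only parsing).
Local Notation aU := 1 (only parsing).
Local Notation aP := 2 (only parsing).
Local Notation aM := 3 (only parsing).
Local Notation aD := 4 (only parsing).
Local Notation aR := 5 (only parsing).

Local Notation "c1 ;; c2" := (CSeq c1 c2) (at level 90, right associativity).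
Local Notation mov x y := (CAdd x y rzero).

(* The outer loop runs at most once: it is a test for 0 < n, needed because the time
   bound does not depend on k when n = 0. *)
Definition prog_budget :=
  CConst rK 0;; CSub rf rone rn;; CSub rf rone rf;;
  CLoop rf (
    CAdd rl1 rl rone;; CWr aU rK rone;; mov rc rk;;
    CLoop rc (CAdd rK rK rl1;; CWr aU rK rone)).

(** The list of masks doubles with each vertex [v]: every mask is copied with [W ^ v] added.
    Repeated addition in [racc] forms [W * W ^ v], the next power; taking [W ^ v] away from it twice
    leaves [K * W ^ v], the new digit of the vector [rtop] of full budgets. *)
Definition prog_masks :=
  CAdd rW rK rone;; CAdd rW rW rone;; mov rw rone;; mov rlen rone;;
  CConst rtop 0;; mov rc0 rn;;
  CLoop rc0 (
    CConst ri 0;; mov rc1 rlen;; mov rj rlen;;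
    CLoop rc1 (
      CRd rq aP ri;; CAdd rq rq rw;; CWr aP rj rq;;
      CAdd ri ri rone;; CAdd rj rj rone);;
    CAdd rlen rlen rlen;; mov rc2 rW;; CConst racc 0;;
    CLoop rc2 (CAdd racc racc rw);;
    CAdd rtop rtop racc;; CSub rtop rtop rw;; CSub rtop rtop rw;;
    mov rw racc).

(** Remainder and quotient are maintained while [x] counts up. The inner loop runs once when the
    remainder reaches [W] and otherwise not at all: it performs the carry. *)
Definition prog_tables :=
  CConst rx 0;; CConst rq 0;; CConst rr 0;; mov rc0 rw;;
  CLoop rc0 (
    CWr aM rx rr;; CWr aD rx rq;; CAdd rx rx rone;; CAdd rr rr rone;;
    CSub rf rW rr;; CSub rf rone rf;;
    CLoop rf (CConst rr 0;; CAdd rq rq rone)).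

(** [rx] drops the digits of the mask one by one, and [ry] runs through the digits that follow the
    current one. Pairs are visited in the order of the encoding, so [re] simply advances by one. *)
Definition prog_cover :=
  mov rx rp;; mov rci rn;;
  CLoop rci (
    CRd rbi aM rx;; CRd rx aD rx;; mov ry rx;; CSub rcj rci rone;;
    CLoop rcj (
      CRd rbj aM ry;; CRd ry aD ry;; CRd rf aE re;; CAdd re re rone;;
      CSub rf rf rbi;; CSub rf rf rbj;; CSub rok rok rf)).

(* Violated conditions are subtracted from [ro], which ends as 1 or 0 and is added to
   the target cell; for illegal moves the target address may be meaningless, but
   then 0 is added. *)
Definition prog_move :=
  CAdd ra rcur rs;; CRd rf aR ra;; CSub rf rone rf;; CSub ro rok rf;;
  mov rx rs;; mov ry rp;; mov rcv rn;;
  CLoop rcv (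
    CRd rd aM rx;; CRd rx aD rx;; CRd rb aM ry;; CRd ry aD ry;;
    CSub rf rb rd;; CSub ro ro rf;;
    CSub rf rone rb;; CRd rg aU rd;; CSub rf rf rg;; CSub ro ro rf);;
  CAdd ra rnxt rs;; CSub ra ra rp;;
  CRd rg aR ra;; CAdd rg rg ro;; CWr aR ra rg;; CAdd rres rres ro.

Definition prog_moves :=
  CRd rp aP rpi;; CAdd rpi rpi rone;; CConst rok 1;; mov re reptr;;
  prog_cover;;
  CConst rs 0;; mov rc2 rw;;
  CLoop rc2 (prog_move;; CAdd rs rs rone).

(** Row [t] of [aR] has length [W ^ n] and starts at [rcur]; moves add to the row at [rnxt]. Every
    mask restarts reading at [reptr], the first edge bit of the step, and after the last mask [re]
    points at the bits of the next step. [rres] counts the legal moves of the latest step and is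
    finally cut down to 0 or 1. *)
Definition prog_steps :=
  CWr aR rtop rone;; CConst rres 1;; CConst rcur 0;; CConst reptr 0;;
  mov rct rtau;;
  CLoop rct (
    CConst rres 0;; CAdd rnxt rcur rw;; CConst rpi 0;; mov rc1 rlen;;
    CLoop rc1 prog_moves;;
    mov reptr re;; mov rcur rnxt);;
  CSub rf rone rres;; CSub rres rone rf.

Definition prog_main :=
  CConst rzero 0;; CConst rone 1;;
  prog_budget;; prog_masks;; prog_tables;; prog_steps.

Lemma wf_main : wf prog_main. Proof. by vm_compute. Qed.

Ltac step1 := eapply ht_step; [cbn [cost]; reflexivity | clear; lia | ].
Ltac steps := repeat (lazymatch goal with
  | |- ht (CSeq (CLoop _ _) _) _ _ _ => fail
  | |- ht (CSeq _ _) _ _ _ => step1 end).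


(** * Correctness and cost of the phases of the program *)

Lemma budget_ht s n k l :
  vr s rn = n -> vr s rk = k -> vr s rl = l -> vr s rzero = 0 -> vr s rone = 1 ->
  (forall i, ar s aU i = 0) ->
  ht prog_budget s (20 + (0 < n) * (k * 12 + 20)) (fun s' =>
    vr s' rK = (0 < n) * (k * l.+1) /\
    (0 < n -> forall d, d <= k * l.+1 -> ar s' aU d = (l.+1 %| d))).
Proof.
move=> hn hk hl h0 h1 hU; rewrite /prog_budget.
steps.
pose I i (s' : state) := vr s' rK = i * (k * l.+1) /\
  (forall d, ar s' aU d = (0 < i) && (d <= k * l.+1) && (l.+1 %| d)).
apply: (ht_weak (ht_loop (n := (0 < n)) (I := I) (T := 12 + k * 12) _ _ _ _)) => //.
- by rewrite /= /upd /= h1 hn; case: n {hn I} => // n; rewrite /= subnn.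
- move=> i s' Hi [F1 F2] Ef [IK IU].
  have i0 : i = 0 by case: (n) Hi => [|?]; case: (i).
  rewrite {}i0 in IK IU Ef Hi *.
  have := F1 rl isT; have := F1 rone isT; have := F1 rzero isT; have := F1 rk isT.
  rewrite /= /upd /= h0 h1 hk hl => ek ez eo el.
  steps.
  pose J j (s' : state) := vr s' rK = j * l.+1 /\
    (forall d, ar s' aU d = (d <= j * l.+1) && (l.+1 %| d)).
  apply: (ht_weak (ht_loop (n := k) (I := J) (T := 8) _ _ _ _)) => //.
  + by rewrite /= /upd /= ek ez addn0.
  + split; rewrite /= /upd /=; first by rewrite IK.
    by case=> [|d] /=; rewrite IK eo ?dvdn0 //= IU.
  + move=> j s2 Hj [G1 G2] Ec [JK JU].
    have := G1 rl1 isT; have := G1 rone isT; rewrite /= /upd /= el eo addn1 => eo2 el2.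
    steps; apply: ht_last => //; split; rewrite /= /upd /= JK el2.
      by rewrite mulSn addnC.
    move=> d; rewrite mulSn addnC; case: eqP => [->|ne].
      by rewrite eo2 leqnn -mulSn dvdn_mull.
    rewrite JU; case: (boolP (l.+1 %| d)) => [/dvdnP[q Eq]|]; last by rewrite !andbF.
    rewrite !andbT Eq -mulSn !leq_pmul2r //.
    have : q <> j.+1 by move=> eq; case: ne; rewrite Eq eq mulSn addnC.
    by lia.
  + lia.
  + by move=> s2 [JK JU] _; rewrite /I /= /upd /= JK mul1n.
- lia.
- move=> s' [IK IU] _; rewrite IK; split=> // Hn d Hd.
  by rewrite IU Hn Hd.
Qed.

Definition tables_ok (s : state) W N :=
  forall x, x < N -> ar s aM x = x %% W /\ ar s aD x = x %/ W.

(** Soundness and completeness of the table of vertex sets; the order of its entries is left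
    open. *)
Definition mask_list W n (P : nat -> nat) :=
  (forall i, i < 2 ^ n ->
     exists2 b : nat -> bool, P i = enc W n b & True) /\
  (forall b : nat -> bool, exists2 i, i < 2 ^ n & P i = enc W n b).

Lemma masks_ht s n K :
  vr s rn = n -> vr s rK = K -> vr s rzero = 0 -> vr s rone = 1 ->
  (forall i, ar s aP i = 0) ->
  ht prog_masks s (20 + n * (24 + 2 ^ n * 21 + K.+2 * 5)) (fun s' =>
    [/\ vr s' rW = K.+2, vr s' rw = K.+2 ^ n, vr s' rlen = 2 ^ n,
        vr s' rtop = enc K.+2 n (fun _ => K) & mask_list K.+2 n (ar s' aP)]).
Proof.
move=> hn hK h0 h1 hP; rewrite /prog_masks.
steps; set W := K.+2.
pose I i (s' : state) :=
  [/\ vr s' rw = W ^ i, vr s' rlen = 2 ^ i,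
        vr s' rtop = enc W i (fun _ => K) & mask_list W i (ar s' aP)].
apply: (ht_weak (ht_loop (n := n) (I := I) (T := 20 + 2 ^ n * 21 + W * 5) _ _ _ _)) => //.
- by rewrite /= /upd /= h0 addn0 hn.
- split; rewrite /= /upd /= ?h0 ?h1 // ?/enc ?big_ord0 //.
  split=> [i Hi|b]; first by exists (fun _ => false) => //; rewrite hP /enc big_ord0.
  by exists 0 => //; rewrite hP /enc big_ord0.
- move=> v s1 Hv [F1 F2] Ec [Iw Ilen Itop [M1 M2]].
  have := F1 rone isT; have := F1 rzero isT; have := F1 rW isT.
  rewrite /= /upd /= h0 h1 hK => eW ez eo.
  steps.
  (* After [i] copies, the first [i] entries of the upper half are those of the lower half with
     digit [v] raised to 1. *)
  pose J i (s' : state) := [/\ vr s' ri = i, vr s' rj = 2 ^ v + i &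
    forall x, ar s' aP x = if (2 ^ v <= x) && (x < 2 ^ v + i) then
       ar s1 aP (x - 2 ^ v) + W ^ v else ar s1 aP x].
  apply: (ht_seq (T2 := 15 + W * 5) (ht_loop (n := 2 ^ v) (I := J) (T := 17) _ _ _ _)) => //.
  + by rewrite /= /upd /= ez Ilen addn0.
  + split; rewrite /= /upd /= ?ez ?Ilen // => x.
    by rewrite addn0 ltnNge andbN.
  + move=> i s2 Hi [G1 G2] _ [J1 J2 J3].
    have := G1 rone isT; have := G1 rw isT; rewrite /= /upd /= eo Iw => ew2 eo2.
    steps; apply: ht_last => //; split; rewrite /= /upd /= ?J1 ?J2 ?eo2 ?addn1 ?addnS //.
    move=> x; case: eqP => [->|ne].
      rewrite leq_addr ltnS leqnn addKn /= J3 ew2.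
      by rewrite leqNgt Hi.
    by rewrite J3 ltnS; have -> : (x <= 2 ^ v + i) = (x < 2 ^ v + i) by lia.
  + move=> s2 [_ _ JP] [G1 G2].
    have := G1 rone isT; have := G1 rzero isT; have := G1 rW isT.
    have := G1 rw isT; have := G1 rlen isT; have := G1 rtop isT.
    rewrite /= /upd /= ez eo eW Iw Ilen Itop => et2 el2 ew2 eW2 ez2 eo2.
    steps.
    pose J2 i (s' : state) := vr s' racc = i * W ^ v.
    apply: (ht_seq (T2 := 10) (ht_loop (n := W) (I := J2) (T := 1) _ _ _ _)) => //.
    * by rewrite /= /upd /= eW2 ez2; lia.
    * move=> i s3 Hi [K1 K2] _ J3.
      have := K1 rw isT; rewrite /= /upd /= ew2 => ew3.
      by apply: ht_last => //; rewrite /J2 /= /upd /= J3 ew3 mulSn addnC.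
    * move=> s3 J3 [K1 K2].
      have := K1 rone isT; have := K1 rzero isT; have := K1 rW isT.
      have := K1 rw isT; have := K1 rlen isT; have := K1 rtop isT.
      rewrite /= /upd /= ez2 eo2 eW2 ew2 el2 et2 => et3 el3 ew3 eW3 ez3 eo3.
      steps; apply: ht_last => //.
      split; rewrite /= /upd /= ?J3 ?ez3 ?et3 ?ew3 ?el3.
      -- by rewrite addn0 expnS.
      -- by rewrite expnS; lia.
      -- rewrite enc_recr /W !mulSn; lia.
      -- split=> [i Hi|b].
           rewrite K2 //= JP; case: (leqP (2 ^ v) i) => Hi'; last first.
             have [//|b Eb _] := M1 i.
             exists (fun u => if u == v then false else b u) => //.
             rewrite enc_recr eqxx mul0n addn0 /= Eb.
             by apply: eq_enc => u Hu; case: eqP => // e; lia.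
           have -> : i < 2 ^ v + 2 ^ v by rewrite expnS in Hi; lia.
           have [|b Eb _] := M1 (i - 2 ^ v); first by rewrite expnS in Hi; lia.
           exists (fun u => if u == v then true else b u) => //.
           rewrite enc_recr eqxx mul1n /= Eb; congr (_ + _).
           by apply: eq_enc => u Hu; case: eqP => // e; lia.
         have [i Hi Ei] := M2 b.
         case Eb : (b v).
           exists (2 ^ v + i); first by rewrite expnS; lia.
           rewrite K2 //= JP leq_addr ltn_add2l Hi /= addKn Ei enc_recr Eb.
           by rewrite mul1n.
         exists i; first by rewrite expnS; lia.
         rewrite K2 //= JP; have -> : (2 ^ v <= i) = false by lia.
         by rewrite /= Ei enc_recr Eb addn0.
    * lia.
  + have : 2 ^ v <= 2 ^ n by rewrite leq_exp2l // ltnW.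
    lia.
- lia.
- move=> s' [I1 I2 I3 I4] [F1 F2]; split=> //.
  by rewrite F1 //= /upd /= hK h1 !addn1.
Qed.

Lemma tables_ht s n W :
  vr s rw = W ^ n -> vr s rW = W -> vr s rzero = 0 -> vr s rone = 1 -> 1 < W ->
  ht prog_tables s (10 + W ^ n * 40) (fun s' => tables_ok s' W (W ^ n)).
Proof.
move=> hw hW h0 h1 W1; rewrite /prog_tables.
steps.
pose I i (s' : state) := [/\ vr s' rx = i, vr s' rq = i %/ W, vr s' rr = i %% W &
  tables_ok s' W i].
apply: (ht_weak (ht_loop (n := W ^ n) (I := I) (T := 30) _ _ _ _)) => //.
- by rewrite /= /upd /= hw h0 addn0.
- by split; rewrite /= /upd /= ?div0n ?mod0n.
- move=> i s1 Hi [F1 F2] _ [Ix Iq Ir It].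
  have := F1 rone isT; have := F1 rW isT; rewrite /= /upd /= h1 hW => eW eo.
  have W0 : 0 < W by exact: ltnW.
  have Hm := ltn_pmod i W0.
  steps.
  (* [b] is the carry, and also the number of runs of the inner loop. *)
  pose b := (i %% W).+1 == W.
  pose J j (s' : state) := [/\ vr s' rx = i.+1, vr s' rq = i %/ W + j,
    vr s' rr = if j == 0 then (i %% W).+1 else 0 & tables_ok s' W i.+1].
  apply: (ht_weak (ht_loop (n := b) (I := J) (T := 2) _ _ _ _)) => //.
  + by rewrite /= /upd /= eo eW Ir /b; lia.
  + split; rewrite /= /upd /= ?Ix ?Iq ?Ir ?eo ?addn1 ?addn0 // => x.
    rewrite ltnS leq_eqVlt /= /upd /=; case: eqP => [->|_] //=.
    by move=> Hx; exact: It.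
  + move=> j s2 Hj [G1 G2] _ [Jx Jq Jr Jt].
    have := G1 rone isT; rewrite /= /upd /= eo => eo2.
    by steps; apply: ht_last => //; split; rewrite /= /upd /= ?Jq ?eo2 ?addn1 ?addnS.
  + by case: b => /=; lia.
  + move=> s2 [Jx Jq Jr Jt] _; split=> //=; rewrite /upd /= ?Jq ?Jr.
    * rewrite /b; have := divn_eq i W; set q := _ %/ W; set r := _ %% W => E.
      have -> : i.+1 = q * W + r.+1 by rewrite addnS -E.
      rewrite divnMDl //; congr (_ + _).
      by case: (r.+1 =P W) => [->|ne]; rewrite ?divnn ?W0 // divn_small //; move: Hm; rewrite -/r; lia.
    * rewrite /b; have := divn_eq i W; set q := _ %/ W; set r := _ %% W => E.
      have -> : i.+1 = q * W + r.+1 by rewrite addnS -E.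
      rewrite modnMDl.
      by case: (r.+1 =P W) => [->|ne] /=; rewrite ?modnn // modn_small //; move: Hm; rewrite -/r; lia.
- lia.
- by move=> s' [].
Qed.

Lemma subn_le1 a b : a <= 1 -> a - b <= 1.
Proof. by move=> ?; apply: leq_trans (leq_subr _ _) _. Qed.

Lemma subn_eq1 a b : a <= 1 -> a - b = 1 -> a = 1 /\ b = 0.
Proof. by lia. Qed.

(** The position in [vpairs] of the first pair whose smaller end is [i]; for [i = n] it is the
    number of all pairs, that is, of bits per step. *)
Definition row_offset n i := \sum_(u < i) (n - u.+1).

Lemma row_offsetS n i : row_offset n i.+1 = row_offset n i + (n - i.+1).
Proof. by rewrite /row_offset big_ord_recr. Qed.

(* With truncated subtraction the equation says that the pair is not an edge or
   that one of its two ends has mask digit 1. *)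
Definition covered W n (A : nat -> nat) e p := forall i j, i < n -> j < n - i.+1 ->
  A (e + row_offset n i + j) - dig W i p - dig W (i.+1 + j) p = 0.

Lemma cover_ht s n W e p :
  vr s rn = n -> vr s rzero = 0 -> vr s rone = 1 -> vr s rok = 1 -> vr s re = e ->
  vr s rp = p -> p < W ^ n -> tables_ok s W (W ^ n) ->
  ht prog_cover s (5 + n * (30 + n * 30)) (fun s' =>
    [/\ vr s' rok <= 1, vr s' rok = 1 <-> covered W n (ar s aE) e p &
        vr s' re = e + row_offset n n]).
Proof.
move=> hn h0 h1 hok he hp Hp tok; rewrite /prog_cover.
have Hd i : p %/ W ^ i < W ^ n by apply: leq_ltn_trans Hp; exact: leq_div.
steps.
(* [rok] starts at 1 and loses each [viol i j] in turn, so it stays 1 exactly when all of them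
   vanish. *)
pose viol i j := ar s aE (e + row_offset n i + j) - dig W i p - dig W (i.+1 + j) p.
pose I i (s' : state) := [/\ vr s' rx = p %/ W ^ i, vr s' re = e + row_offset n i,
  vr s' rok <= 1 & vr s' rok = 1 <-> (forall i' j, i' < i -> j < n - i'.+1 -> viol i' j = 0)].
apply: (ht_weak (ht_loop (n := n) (I := I) (T := 20 + n * 30) _ _ _ _)) => //.
- by rewrite /= /upd /= hn h0 addn0.
- by split; rewrite /= /upd /= ?hp ?h0 ?hok ?he ?expn0 ?divn1 ?addn0 // /row_offset big_ord0 addn0.
- move=> i s1 Hi [F1 F2] Ec [Ix Ie Iok IP].
  have := F1 rone isT; have := F1 rzero isT; rewrite /= /upd /= h0 h1 => ez eo.
  have F2' a j : ar s1 a j = ar s a j by rewrite F2.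
  steps.
  pose J j (s' : state) := [/\ vr s' ry = p %/ W ^ (i.+1 + j),
    vr s' re = e + row_offset n i + j, vr s' rok <= 1 &
    vr s' rok = 1 <-> (forall i' j, i' < i -> j < n - i'.+1 -> viol i' j = 0) /\
                      (forall j', j' < j -> viol i j' = 0)].
  apply: (ht_weak (ht_loop (n := n - i.+1) (I := J) (T := 26) _ _ _ _)) => //.
  + by rewrite /= /upd /= eo Ec; lia.
  + split; rewrite /= /upd /= ?Ie ?ez ?addn0 ?Ix ?F2' //.
      by rewrite (tok _ (Hd i)).2 divn_expS.
    by rewrite IP; split=> [H|[H _]] //; split.
  + move=> j s2 Hj [G1 G2] _ [Jy Je Jok JP].
    have := G1 rone isT; have := G1 rbi isT.
    rewrite /= /upd /= eo Ix F2' (tok _ (Hd i)).1 => eb eo2.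
    have G2' a x : ar s2 a x = ar s a x by rewrite G2 // F2'.
    steps; apply: ht_last; first by [].
    have Ev : vr (eval (CSub rok rok rf) (eval (CSub rf rf rbj) (eval (CSub rf rf rbi)
       (eval (CAdd re re rone) (eval (CRd rf aE re) (eval (CRd ry aD ry)
       (eval (CRd rbj aM ry) s2))))))) rok = vr s2 rok - viol i j.
      rewrite /= /upd /= eb !G2' Jy Je (tok _ (Hd _)).1 //.
    split.
    * by rewrite /= /upd /= G2' Jy (tok _ (Hd _)).2 divn_expS addnS.
    * by rewrite /= /upd /= Je eo2 addn1 addnS.
    * by rewrite [vr _ _]Ev; exact: subn_le1.
    * rewrite [vr _ _]Ev; split=> [H|[H1 H2]].
        have [Hok V0] := subn_eq1 Jok H.
        have [H1 H2] := JP.1 Hok; split=> // j'; rewrite ltnS leq_eqVlt.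
        by case/orP=> [/eqP->|]; [exact: V0|exact: H2].
      have -> : vr s2 rok = 1 by apply/JP; split=> // j' Hj'; apply: H2; exact: ltnW.
      by rewrite H2.
  + have : (n - i.+1) * (26 + 4) <= n * 30 by rewrite leq_mul2r leq_subr orbT.
    clear; lia.
  + move=> s2 [Jy Je Jok JP] [G1 G2].
    have := G1 rx isT; rewrite /= /upd /= F2' Ix (tok _ (Hd _)).2 divn_expS => ex.
    split; rewrite /= /upd /= ?ex ?Je ?row_offsetS ?addnA // JP.
    split=> [[H1 H2] i' j|H].
      by rewrite ltnS leq_eqVlt => /orP[/eqP->|]; [exact: H2|exact: H1].
    by split=> [i' j Hi' Hj|j Hj]; apply: H => //; exact: ltnW.
- lia.
- by move=> s' [_ -> H1 H2] _; split.
Qed.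

(** With mask digits 0 and 1, the first summand vanishes when an active vertex has a unit left to
    spend, the second when an idle vertex has a budget marked in [U]. *)
Definition move_ok W n (U : nat -> nat) p x := forall v, v < n ->
  (dig W v p - dig W v x) + (1 - dig W v p - U (dig W v x)) = 0.

Lemma move_ht s n W cur nxt p x ok :
  vr s rn = n -> vr s rzero = 0 -> vr s rone = 1 -> vr s rok = ok -> ok <= 1 ->
  vr s rcur = cur -> vr s rnxt = nxt ->
  vr s rp = p -> p < W ^ n -> vr s rs = x -> x < W ^ n -> tables_ok s W (W ^ n) ->
  ht prog_move s (40 + n * 45) (fun s' => exists2 o,
    (o = 1 <-> [/\ ok = 1, ar s aR (cur + x) <> 0 & move_ok W n (ar s aU) p x]) &
    [/\ o <= 1, forall a, ar s' aR a = ar s aR a + (a == nxt + x - p) * o &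
        vr s' rres = vr s rres + o]).
Proof.
move=> hn h0 h1 hok Hok hcur hnxt hp Hp hx Hx tok; rewrite /prog_move.
have Hd i : p %/ W ^ i < W ^ n by apply: leq_ltn_trans Hp; exact: leq_div.
have Hd' i : x %/ W ^ i < W ^ n by apply: leq_ltn_trans Hx; exact: leq_div.
steps.
pose viol v := (dig W v p - dig W v x) + (1 - dig W v p - ar s aU (dig W v x)).
pose I i (s' : state) := [/\ vr s' rx = x %/ W ^ i, vr s' ry = p %/ W ^ i,
  vr s' ro <= 1 & vr s' ro = 1 <-> [/\ ok = 1, ar s aR (cur + x) <> 0 &
     forall v, v < i -> viol v = 0]].
apply: (ht_seq (T2 := 20) (ht_loop (n := n) (I := I) (T := 41) _ _ _ _)) => //.
- by rewrite /= /upd /= hn h0 addn0.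
- split; rewrite /= /upd /= ?hp ?hx ?h0 ?h1 ?hok ?hcur ?expn0 ?divn1 ?addn0 //; first exact: subn_le1.
  split=> [H|[-> H2 _]]; last by case: (ar s aR _) H2.
  by have [-> H2] := subn_eq1 Hok H; split=> // H3; rewrite H3 in H2.
- move=> i s1 Hi [F1 F2] Ec [Ix Iy Io IP].
  have := F1 rone isT; rewrite /= /upd /= h1 => eo.
  have F2' a j : ar s1 a j = ar s a j by rewrite F2.
  steps; apply: ht_last; first by [].
  have Ev : vr (eval (CSub ro ro rf) (eval (CSub rf rf rg) (eval (CRd rg aU rd)
    (eval (CSub rf rone rb) (eval (CSub ro ro rf) (eval (CSub rf rb rd)
    (eval (CRd ry aD ry) (eval (CRd rb aM ry) (eval (CRd rx aD rx)
    (eval (CRd rd aM rx) s1)))))))))) ro = vr s1 ro - viol i.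
    rewrite /= /upd /= eo !F2' Ix Iy !(tok _ (Hd _)).1 !(tok _ (Hd' _)).1.
    by rewrite /viol subnDA.
  split.
  + by rewrite /= /upd /= F2' Ix (tok _ (Hd' _)).2 divn_expS.
  + by rewrite /= /upd /= F2' Iy (tok _ (Hd _)).2 divn_expS.
  + by rewrite [vr _ _]Ev; exact: subn_le1.
  + rewrite [vr _ _]Ev; split=> [H|[H1 H2 H3]].
      have [Ho V0] := subn_eq1 Io H.
      have [H1 H2 H3] := IP.1 Ho; split=> // v; rewrite ltnS leq_eqVlt.
      by case/orP=> [/eqP->|]; [exact: V0|exact: H3].
    have -> : vr s1 ro = 1 by apply/IP; split=> // v Hv; apply: H3; exact: ltnW.
    by rewrite H3.
- move=> s1 [_ _ Io IP] [F1 F2].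
  have := F1 rnxt isT; have := F1 rs isT; have := F1 rp isT; have := F1 rres isT.
  rewrite /= /upd /= hnxt hx hp => er ep es en.
  steps; apply: ht_last => //; exists (vr s1 ro); first exact: IP.
  split=> //; rewrite /= /upd /= ?er // => a.
  rewrite es en ep !F2 //=.
  by case: eqP => [->|_]; rewrite ?mul1n ?mul0n ?addn0.
- lia.
Qed.

(** For a legal move the subtraction in the target address is therefore not truncated, and the
    target lies in the next row. *)
Lemma move_ok_le W n U p x : p < W ^ n -> x < W ^ n -> move_ok W n U p x -> p <= x.
Proof.
move=> Hp Hx H; rewrite -(enc_dig Hp) -(enc_dig Hx); apply: leq_sum => v _.
by rewrite leq_mul2r; have := H v (ltn_ord v); case: leqP; rewrite ?orbT //; lia.
Qed.

Lemma neq0_addn a b : a + b <> 0 <-> a <> 0 \/ b <> 0.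
Proof. lia. Qed.

Section Moves.
Variables (W n e cur : nat) (s0 : state).
Local Notation N := (W ^ n).

(** Evaluated in the state [s0] at the start of the step: effective writes go to the next row only,
    so the current row keeps its content while all masks are tried. *)
Definition transition p x :=
  [/\ covered W n (ar s0 aE) e p, ar s0 aR (cur + x) <> 0 &
      move_ok W n (ar s0 aU) p x].

Lemma moves_ht s i p :
  vr s rn = n -> vr s rzero = 0 -> vr s rone = 1 -> vr s rw = N ->
  vr s rcur = cur -> vr s rnxt = cur + N -> vr s reptr = e -> vr s rpi = i ->
  tables_ok s W N -> ar s aP i = p -> p < N ->
  (forall a, ar s aE a = ar s0 aE a) -> (forall a, ar s aU a = ar s0 aU a) ->
  (forall a, a < cur + N -> ar s aR a = ar s0 aR a) ->
  ht prog_moves s (30 + n * (30 + n * 30) + N * (50 + n * 45)) (fun s' =>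
    [/\ vr s' rpi = i.+1, vr s' re = e + row_offset n n,
      forall a, a < cur + N \/ cur + N + N <= a -> ar s' aR a = ar s aR a,
      forall y, y < N -> ar s' aR (cur + N + y) <> 0 <->
        ar s aR (cur + N + y) <> 0 \/ exists2 x, x < N & transition p x /\ y = x - p &
      vr s' rres <> 0 <-> vr s rres <> 0 \/ exists2 x, x < N & transition p x]).
Proof.
move=> hn h0 h1 hw hcur hnxt he hi tok hp Hp hE hU hR; rewrite /prog_moves.
steps.
apply: (ht_seq (T2 := 5 + N * (50 + n * 45)) (@cover_ht _ n W e p _ _ _ _ _ _ _ _)) => //.
- by rewrite /= /upd /= h0 he addn0.
- by rewrite /= /upd /= hi.
- move=> s1 [Cok CP Ce] [F1 F2].
  have := F1 rone isT; have := F1 rzero isT; have := F1 rpi isT; have := F1 rw isT.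
  have := F1 rn isT; have := F1 rcur isT; have := F1 rnxt isT; have := F1 rp isT.
  have := F1 rres isT.
  rewrite /= /upd /= h0 h1 hn hw hcur hnxt hi hp addn1 => eres ep enx ecur en ew epi ez eo.
  have F2' a x : ar s1 a x = ar s a x by rewrite F2.
  steps.
  pose I j (s' : state) := [/\ vr s' rs = j,
    forall a, a < cur + N \/ cur + N + N <= a -> ar s' aR a = ar s aR a,
    forall y, y < N -> ar s' aR (cur + N + y) <> 0 <->
        ar s aR (cur + N + y) <> 0 \/ exists2 x, x < j & transition p x /\ y = x - p &
    vr s' rres <> 0 <-> vr s rres <> 0 \/ exists2 x, x < j & transition p x].
  apply: (ht_weak (ht_loop (n := N) (I := I) (T := 41 + n * 45) _ _ _ _)) => //.
  + by rewrite /= /upd /= ew ez addn0.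
  + split; rewrite /= /upd /=.
    * by [].
    * by move=> a _; rewrite F2'.
    * by move=> y _; rewrite F2'; split=> [H|[//|[x]]]; [left|].
    * by rewrite eres; split=> [H|[//|[x]]]; [left|].
  + move=> j s2 Hj [G1 G2] _ [Is Iout IR Ires].
    have := G1 rone isT; have := G1 rzero isT; have := G1 rok isT.
    have := G1 rn isT; have := G1 rcur isT; have := G1 rnxt isT; have := G1 rp isT.
    rewrite /= /upd /= ez eo en ecur enx ep => ep2 enx2 ec2 en2 eok2 ez2 eo2.
    have G2' a x : a != aR -> ar s2 a x = ar s a x.
      by move=> Ha; rewrite G2 /= ?F2' // !inE.
    apply: (ht_seq (T2 := 1) (@move_ht _ n W cur (cur + N) p j (vr s1 rok) _ _ _ _ _ _ _ _ _ _ _ _)) => //.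
    * by move=> x Hx; rewrite !G2' //; exact: tok.
    * move=> s3 [o Po [Ho1 HD Hres]] [K1 K2].
      have := K1 rone isT; have := K1 rs isT; rewrite Is eo2 => es3 eo3.
      apply: ht_last; first by [].
      have cj : cur + j < cur + N by rewrite ltn_add2l.
      have Po' : o = 1 <-> transition p j.
        have ER : ar s2 aR (cur + j) = ar s0 aR (cur + j) by rewrite Iout ?hR //; left.
        have EU v : ar s2 aU v = ar s0 aU v by rewrite G2' // hU.
        rewrite ER in Po; split=> [/Po[/CP H1 H2 H3]|[H1 H2 H3]].
          split=> // [u v Hu Hv|v Hv].
            by rewrite -hE; exact: H1.
          by rewrite -EU; exact: H3.
        apply/Po; split=> //; last by move=> v Hv; rewrite EU; exact: H3.
        by apply/CP => u v Hu Hv; rewrite hE; exact: H1.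
      have Ho0 : o <> 0 <-> transition p j.
        by apply: (iff_trans _ Po'); clear -Ho1; lia.
      have Hle : transition p j -> p <= j.
        by case=> _ _; apply: move_ok_le => //; exact: ltn_trans Hj _.
      split; rewrite /= /upd /=.
      -- by rewrite es3 eo3 addn1.
      -- move=> a Ha; rewrite HD Iout //; case: eqP => [Ea|_]; last by rewrite mul0n addn0.
         case: (o =P 0) => [->|/Ho0/Hle Hpj]; first by rewrite muln0 addn0.
         by clear -Ha Ea Hpj Hj; lia.
      -- move=> y Hy; rewrite HD neq0_addn IR //.
         split=> [[[H|[x Hx [H1 H2]]]|H]|[H|[x]]].
         ++ by left.
         ++ by right; exists x => //; exact: ltnW.
         ++ right; exists j => //; move: H; case: eqP => [E|_]; last by rewrite mul0n.
            rewrite mul1n => /Ho0 T; split=> //; have := Hle T.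
            by clear -E; lia.
         ++ by left; left.
         ++ rewrite ltnS leq_eqVlt => /orP[/eqP-> [T E]|Hx TE].
              right; rewrite E addnBA ?eqxx; last exact: Hle.
              by rewrite mul1n; apply/Ho0.
            by left; right; exists x.
      -- rewrite Hres neq0_addn Ires Ho0.
         split=> [[[H|[x Hx H1]]|H]|[H|[x]]].
         ++ by left.
         ++ by right; exists x => //; exact: ltnW.
         ++ by right; exists j.
         ++ by left; left.
         ++ rewrite ltnS leq_eqVlt => /orP[/eqP-> T|Hx TE]; first by right.
            by left; right; exists x.
    * by clear; lia.
  + by clear; lia.
  + move=> s2 [Is Iout IR Ires] [G1 G2]; split=> //.
      by have := G1 rpi isT; rewrite /= /upd /= epi.
    by have := G1 re isT; rewrite /= /upd /= Ce.
- by clear; lia.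
Qed.

End Moves.

(** The set of codes that row [t] of [aR] marks with nonzero entries, described without program
    states. *)
Fixpoint reach W n K (A U : nat -> nat) t y :=
  if t is t'.+1 then exists (b : nat -> bool) x,
    [/\ x < W ^ n, covered W n A (t' * row_offset n n) (enc W n b),
        reach W n K A U t' x, move_ok W n U (enc W n b) x & y = x - enc W n b]
  else y = enc W n (fun _ => K).

Lemma eq_reach W n K A A' U t y : (forall a, A a = A' a) ->
  reach W n K A U t y -> reach W n K A' U t y.
Proof.
move=> EA; elim: t y => //= t IH y [b [x [Hx H1 H2 H3 ->]]].
exists b, x; split=> //; last exact: IH.
by move=> i j Hi Hj; rewrite -EA; exact: H1.
Qed.

Lemma steps_ht s n K tau :
  let W := K.+2 in
  vr s rn = n -> vr s rzero = 0 -> vr s rone = 1 -> vr s rw = W ^ n ->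
  vr s rlen = 2 ^ n -> vr s rtop = enc W n (fun _ => K) -> vr s rtau = tau ->
  tables_ok s W (W ^ n) -> mask_list W n (ar s aP) ->
  (forall a, ar s aR a = 0) ->
  ht prog_steps s (20 + tau * (20 + 2 ^ n * (40 + n * (30 + n * 30) + W ^ n * (50 + n * 45))))
   (fun s' => vr s' rres <= 1 /\ (vr s' rres = 1 <->
      exists2 x, x < W ^ n & reach W n K (ar s aE) (ar s aU) tau x)).
Proof.
move=> W hn h0 h1 hw hlen htop htau tok [M1 M2] hR; rewrite /prog_steps.
have Htop : enc W n (fun _ => K) < W ^ n by apply: enc_lt.
pose N := W ^ n; pose P := ar s aP.
have HP i : i < 2 ^ n -> P i < N.
  by move=> Hi; rewrite /P; have [b -> _] := M1 i Hi; apply: enc_lt => v _; case: (b v).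
pose Rch := reach W n K (ar s aE) (ar s aU).
pose ro := row_offset n n.
steps.
(* Cells beyond row [t] are still zero, so a cell of the next row becomes nonzero exactly when some
   move reaches it. *)
pose I t (s' : state) := [/\ vr s' rcur = t * N, vr s' reptr = t * ro,
  forall a, t * N + N <= a -> ar s' aR a = 0,
  forall x, x < N -> ar s' aR (t * N + x) <> 0 <-> Rch t x &
  vr s' rres <> 0 <-> exists2 x, x < N & Rch t x].
apply: (ht_seq (T2 := 5) (ht_loop (n := tau) (I := I)
  (T := 15 + 2 ^ n * (40 + n * (30 + n * 30) + N * (50 + n * 45))) _ _ _ _)) => //.
- by rewrite /= /upd /= htau h0 addn0.
- split; rewrite /= /upd /=.
  + by [].
  + by [].
  + move=> a Ha; case: eqP => [Ea|_]; last exact: hR.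
    by move: Ha Htop; rewrite /N Ea htop; clear; lia.
  + move=> x Hx; rewrite h1 htop hR add0n /Rch /=.
    by case: eqP => [->|ne]; split.
  + by split=> // _; exists (enc W n (fun _ => K)).
- move=> t s1 Ht [F1 F2] _ [Icur Ie Iout IR Ires].
  have := F1 rone isT; have := F1 rzero isT; have := F1 rw isT.
  have := F1 rn isT; have := F1 rlen isT.
  rewrite /= /upd /= h0 h1 hn hw hlen => el en ew ez eo.
  have F2' a x : a != aR -> ar s1 a x = ar s a x.
    by move=> Ha; rewrite F2 /= ?(negbTE Ha) // !inE.
  steps.
  pose tr p x := transition W n (t * ro) (t * N) s1 p x.
  (* [re] has its value only once a mask has been processed, hence the condition [0 < i]; there are
     [2 ^ n > 0] masks. *)
  pose J i (s' : state) := [/\ vr s' rpi = i, 0 < i -> vr s' re = t * ro + row_offset n n,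
    forall a, a < t * N + N \/ t * N + N + N <= a -> ar s' aR a = ar s1 aR a,
    forall y, y < N -> ar s' aR (t * N + N + y) <> 0 <->
       exists2 i', i' < i & exists2 x, x < N & tr (P i') x /\ y = x - P i' &
    vr s' rres <> 0 <-> exists2 i', i' < i & exists2 x, x < N & tr (P i') x].
  apply: (ht_seq (T2 := 5) (ht_loop (n := 2 ^ n) (I := J)
    (T := 30 + n * (30 + n * 30) + N * (50 + n * 45)) _ _ _ _)) => //.
  + by rewrite /= /upd /= el ez addn0.
  + split; rewrite /= /upd /= //.
      move=> y Hy; rewrite Iout; last by rewrite leq_addr.
      by split=> // [[]].
    by split=> // [[]].
  + move=> i s2 Hi [G1 G2] _ [Jpi Je Jout JR Jres].
    have := G1 rone isT; have := G1 rzero isT; have := G1 rw isT.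
    have := G1 rn isT; have := G1 rcur isT; have := G1 rnxt isT; have := G1 reptr isT.
    rewrite /= /upd /= en ez eo ew Icur Ie => ee2 enx2 ecur2 en2 ew2 ez2 eo2.
    have G2' a x : a != aR -> ar s2 a x = ar s1 a x.
      by move=> Ha; rewrite G2 /= // !inE.
    apply: (ht_weak (@moves_ht W n (t * ro) (t * N) s1 s2 i (P i)
      _ _ _ _ _ _ _ _ _ _ _ _ _ _)) => //.
    * by move=> x Hx; rewrite !G2' // !F2' //; exact: tok.
    * by rewrite G2' // F2'.
    * exact: HP.
    * by move=> a; rewrite G2'.
    * by move=> a; rewrite G2'.
    * by move=> a Ha; rewrite Jout //; left.
    * move=> s3 [Kpi Ke Kout KR Kres] _.
      split; rewrite /= /upd /=.
      -- exact: Kpi.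
      -- by move=> _; exact: Ke.
      -- by move=> a Ha; rewrite Kout // Jout.
      -- move=> y Hy; rewrite KR // JR //; split=> [[[i' Hi' H]|H]|[i']].
         ++ by exists i' => //; exact: ltnW.
         ++ by exists i.
         ++ rewrite ltnS leq_eqVlt => /orP[/eqP-> H|Hi' H]; first by right.
            by left; exists i'.
      -- rewrite Kres Jres; split=> [[[i' Hi' H]|H]|[i']].
         ++ by exists i' => //; exact: ltnW.
         ++ by exists i.
         ++ rewrite ltnS leq_eqVlt => /orP[/eqP-> H|Hi' H]; first by right.
            by left; exists i'.
  + move=> s2 [Jpi Je Jout JR Jres] [G1 G2].
    have := G1 rzero isT; have := G1 rnxt isT.
    rewrite /= /upd /= ez ew Icur => enx2 ez2.
    steps; apply: ht_last; first by [].
    have trE b x : x < N -> tr (enc W n b) x <->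
      [/\ covered W n (ar s aE) (t * ro) (enc W n b), Rch t x &
          move_ok W n (ar s aU) (enc W n b) x].
      move=> Hx; rewrite /tr /transition /covered /move_ok.
      split=> [[H1 H2 H3]|[H1 H2 H3]].
        split; first by move=> u v Hu Hv; rewrite -F2' //; exact: H1.
          by apply/IR.
        by move=> v Hv; rewrite -F2' //; exact: H3.
      split; first by move=> u v Hu Hv; rewrite F2' //; exact: H1.
        by apply/IR.
      by move=> v Hv; rewrite F2' //; exact: H3.
    split; rewrite /= /upd /=.
    * by rewrite enx2 ez2 addn0 mulSn addnC.
    * by rewrite ez2 addn0 Je ?expn_gt0 // mulSn addnC.
    * move=> a Ha; rewrite mulSn in Ha; rewrite Jout; last first.
        by right; move: Ha; clear; lia.
      by apply: Iout; move: Ha; clear; lia.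
    * move=> y Hy; have -> : t.+1 * N + y = t * N + N + y by rewrite mulSn (addnC N).
      rewrite JR //; split.
        case=> i Hi [x Hx [T ->]]; have [b Eb _] := M1 i Hi.
        move: T; rewrite /P Eb => /(trE _ _ Hx)[H1 H2 H3].
        by exists b, x; split.
      case=> b [x [Hx H1 H2 H3 ->]]; have [i Hi Ei] := M2 b.
      exists i => //; exists x => //; rewrite /P Ei; split=> //.
      by apply/trE => //.
    * rewrite Jres; split.
        case=> i Hi [x Hx T]; have [b Eb _] := M1 i Hi.
        exists (x - P i); first by apply: leq_ltn_trans Hx; exact: leq_subr.
        move: T; rewrite /P Eb => /(trE _ _ Hx)[H1 H2 H3].
        by exists b, x; split.
      case=> y Hy [b [x [Hx H1 H2 H3 _]]]; have [i Hi Ei] := M2 b.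
      exists i => //; exists x => //; rewrite /P Ei.
      by apply/trE => //.
  + by clear; lia.
- move=> s1 [_ _ _ _ Ires] [F1 F2].
  have := F1 rone isT; rewrite /= /upd /= h1 => eo.
  steps; apply: ht_last; first by [].
  rewrite /= /upd /= eo; split; first by clear; lia.
  by apply: (iff_trans _ Ires); clear; lia.
- by rewrite /N; clear; lia.
Qed.

Lemma main_ht s n k l tau :
  let K := (0 < n) * (k * l.+1) in let W := K.+2 in
  vr s rn = n -> vr s rk = k -> vr s rl = l -> vr s rtau = tau ->
  (forall a i, 0 < a < 8 -> ar s a i = 0) ->
  ht prog_main s (100 + (0 < n) * (k * 12 + 20) + n * (24 + 2 ^ n * 21 + W * 5) +
      W ^ n * 40 +
      tau * (20 + 2 ^ n * (40 + n * (30 + n * 30) + W ^ n * (50 + n * 45))))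
   (fun s' => vr s' rres <= 1 /\ exists2 U : nat -> nat,
      (0 < n -> forall d, d <= K -> U d = (l.+1 %| d)) &
      (vr s' rres = 1 <->
      exists2 x, x < W ^ n & reach W n K (ar s aE) U tau x)).
Proof.
move=> K W hn hk hl htau hA; rewrite /prog_main.
set TT := tau * _; set TM := n * _.
steps.
apply: (ht_seq (T2 := 60 + TM + W ^ n * 40 + TT) (@budget_ht _ n k l _ _ _ _ _ _)) => //.
  by move=> i; rewrite /= hA.
- move=> s1 [hK hU] [F1 F2].
  apply: (ht_seq (T2 := 40 + W ^ n * 40 + TT) (@masks_ht s1 n K _ _ _ _ _)) => //.
  + by rewrite F1.
  + by rewrite F1.
  + by rewrite F1.
  + by move=> i; rewrite F2 //= hA.
  + move=> s2 [eW ew elen etop M] [G1 G2].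
    apply: (ht_seq (T2 := 20 + TT) (@tables_ht s2 n W _ _ _ _ _)) => //.
    * by rewrite G1 ?F1.
    * by rewrite G1 ?F1.
    * move=> s3 tok [H1 H2].
      apply: (ht_weak (@steps_ht s3 n K tau _ _ _ _ _ _ _ _ _ _)) => //.
      -- by rewrite H1 ?G1 ?F1.
      -- by rewrite H1 ?G1 ?F1.
      -- by rewrite H1 ?G1 ?F1.
      -- by rewrite H1.
      -- by rewrite H1.
      -- by rewrite H1.
      -- by rewrite H1 ?G1 ?F1.
      -- have [M1 M2] := M; split=> [i|b]; first by rewrite H2 //; exact: M1.
         by have [i Hi Ei] := M2 b; exists i; rewrite ?H2.
      -- by move=> a; rewrite H2 ?G2 ?F2 //= hA.
      -- move=> s4 [R1 R2] _; split=> //; exists (ar s3 aU).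
           move=> Hn d Hd; rewrite H2 ?G2 //; apply: hU => //.
           by move: Hd; rewrite /K Hn mul1n.
         have E a : ar s3 aE a = ar s aE a by rewrite H2 ?G2 ?F2.
         rewrite R2; split=> [[x Hx H]|[x Hx H]]; exists x => //.
           exact: eq_reach H.
         by apply: eq_reach H => a; rewrite E.
    * by clear; lia.
  + by rewrite /TM -/W; clear; lia.
- by rewrite /TM -/W; clear; lia.
Qed.

(** * The encoding of the edge sets *)

Lemma nth_flatten_iota (T : Type) (x0 : T) (F : nat -> seq T) a m i j :
  i < m -> j < size (F (a + i)) ->
  nth x0 (flatten [seq F u | u <- iota a m]) (\sum_(u < i) size (F (a + u)) + j) =
  nth x0 (F (a + i)) j.
Proof.
elim: m a i => // m IH a [|i] Hi Hj /=; rewrite nth_cat.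
  by rewrite big_ord0 add0n; rewrite addn0 in Hj *; rewrite Hj.
rewrite big_ord_recl addn0 -addnA ltnNge leq_addr /= addKn addnS -addSn.
rewrite -IH //; last by rewrite addSnnS.
congr (nth _ _ (_ + _)); apply: eq_bigr => u _; congr (size (F _)).
by rewrite /= /bump /=; lia.
Qed.

(* Step [t] of a schedule is time [t.+1] of the temporal graph. *)
Definition edge (n : nat) (E : nat -> 'I_n -> 'I_n -> bool) t (i j : nat) : bool :=
  match @insub nat (fun i => i < n) 'I_n i, @insub nat (fun i => i < n) 'I_n j with
  | Some u, Some v => E t.+1 u v
  | _, _ => false
  end.

Lemma edge_ord n E t (u v : 'I_n) : edge E t u v = E t.+1 u v.
Proof. by rewrite /edge !valK. Qed.

Lemma map_enum_ord (T : Type) n (G : nat -> T) (p : pred nat) :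
  [seq G (val j) | j : 'I_n <- enum 'I_n & p (val j)] =
  [seq G j | j <- iota 0 n & p j].
Proof. by rewrite -val_enum_ord filter_map -map_comp. Qed.

Lemma filter_gt_iota i n : i < n -> [seq j <- iota 0 n | i < j] = iota i.+1 (n - i.+1).
Proof.
move=> Hi; rewrite -[in iota 0 n](subnKC Hi) iotaD filter_cat add0n.
have /eq_in_filter-> : {in iota 0 i.+1, (fun j => i < j) =1 pred0}.
  by move=> j; rewrite mem_iota /=; lia.
rewrite filter_pred0 cat0s.
by apply/all_filterP/allP => j; rewrite mem_iota; lia.
Qed.

Definition edge_row n (E : nat -> 'I_n -> 'I_n -> bool) t i : seq nat :=
  [seq nat_of_bool (edge E t i j) | j <- iota i.+1 (n - i.+1)].

Lemma map_vpairs n (E : nat -> 'I_n -> 'I_n -> bool) t :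
  [seq nat_of_bool (E t.+1 p.1 p.2) | p <- vpairs n] =
  flatten [seq edge_row E t i | i <- iota 0 n].
Proof.
rewrite /vpairs map_flatten -map_comp -val_enum_ord -map_comp; congr flatten.
apply: eq_map => i /=; rewrite -map_comp.
rewrite /edge_row -filter_gt_iota // -map_enum_ord.
by apply: eq_map => j /=; rewrite edge_ord.
Qed.

Lemma size_edge_row n (E : nat -> 'I_n -> 'I_n -> bool) t i : size (edge_row E t i) = n - i.+1.
Proof. by rewrite size_map size_iota. Qed.

Lemma size_vpairs n : size (vpairs n) = row_offset n n.
Proof.
(* Mapping the bits of a complete graph preserves the length and makes [map_vpairs] applicable. *)
rewrite -(size_map (fun p => nat_of_bool ((fun _ _ _ => true) 1 p.1 p.2))).
rewrite (map_vpairs (fun _ _ _ => true) 0) size_flatten /shape -map_comp.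
rewrite sumnE big_map /row_offset -(big_mkord xpredT (fun u => n - u.+1)).
rewrite /index_iota subn0; apply: eq_bigr => i _.
exact: size_edge_row.
Qed.

Lemma row_offset_addn n a d : row_offset n a <= row_offset n (a + d).
Proof.
elim: d => [|d IH]; first by rewrite addn0.
by apply: leq_trans IH _; rewrite addnS row_offsetS leq_addr.
Qed.

Definition edge_bits n tau (E : nat -> 'I_n -> 'I_n -> bool) :=
  flatten [seq [seq nat_of_bool (E t p.1 p.2) | p <- vpairs n] | t <- iota 1 tau].

Lemma nth_edge_bits n tau (E : nat -> 'I_n -> 'I_n -> bool) t i j :
  t < tau -> i < n -> j < n - i.+1 ->
  nth 0 (edge_bits tau E) (t * row_offset n n + row_offset n i + j) =
  edge E t i (i.+1 + j).
Proof.
move=> Ht Hi Hj.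
have Hrow : row_offset n i + j < row_offset n n.
  have : row_offset n i.+1 <= row_offset n n.
    by have := row_offset_addn n i.+1 (n - i.+1); rewrite subnKC.
  by apply: leq_trans; rewrite row_offsetS -addnS leq_add2l.
have S t' : size [seq nat_of_bool (E (1 + t') p.1 p.2) | p <- vpairs n] = row_offset n n.
  by rewrite size_map size_vpairs.
have := @nth_flatten_iota _ 0 (fun t => [seq nat_of_bool (E t p.1 p.2) | p <- vpairs n])
  1 tau t (row_offset n i + j) Ht; rewrite S => /(_ Hrow).
rewrite (eq_bigr (fun _ => row_offset n n)) // sum_nat_const card_ord addnA.
rewrite /edge_bits => ->; rewrite add1n map_vpairs.
have := @nth_flatten_iota _ 0 (edge_row E t) 0 n i j Hi; rewrite add0n size_edge_row.
move=> /(_ Hj); rewrite (eq_bigr (fun u : 'I_i => n - u.+1)); last first.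
  by move=> u _; rewrite size_edge_row.
by rewrite /row_offset => ->; rewrite (nth_map 0) ?size_iota // nth_iota.
Qed.

Lemma size_edge_bits n tau (E : nat -> 'I_n -> 'I_n -> bool) :
  size (edge_bits tau E) <= tau * (n * n).
Proof.
rewrite /edge_bits size_flatten /shape -map_comp sumnE big_map.
rewrite (eq_bigr (fun _ => row_offset n n)); last first.
  by move=> t _ /=; rewrite size_map size_vpairs.
rewrite big_const_seq count_predT size_iota iter_addn_0 mulnC leq_mul2l.
apply/orP; right; rewrite /row_offset -[X in X * n]card_ord -sum_nat_const.
by apply: leq_sum => i _; exact: leq_subr.
Qed.

(** * Schedules and timelines *)

(* Active time units that a vertex may still spend before step [t]. *)
Fixpoint budget (K : nat) (b : nat -> nat -> bool) t v :=
  if t is t'.+1 then budget K b t' v - b t' v else K.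

Definition legal l d (a : bool) := if a then 0 < d else l.+1 %| d.

Definition schedule n l K (E : nat -> 'I_n -> 'I_n -> bool) tau b :=
  forall t, t < tau ->
    (forall i j, i < j -> j < n -> edge E t i j -> b t i || b t j) /\
    (forall v, v < n -> legal l (budget K b t v) (b t v)).

Lemma budget_le K b t v : budget K b t v <= K.
Proof. by elim: t => //= t IH; lia. Qed.

Lemma eq_budget K b b' t v : (forall t', t' < t -> b t' =1 b' t') ->
  budget K b t v = budget K b' t v.
Proof. by elim: t => //= t IH H; rewrite IH ?H // => t' Ht'; apply: H; exact: ltnW. Qed.

Lemma reach_schedule n l K (E : nat -> 'I_n -> 'I_n -> bool) tau
    (A U : nat -> nat) :
  let W := K.+2 in
  (forall t i j, t < tau -> i < n -> j < n - i.+1 ->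
     A (t * row_offset n n + row_offset n i + j) = edge E t i (i.+1 + j)) ->
  (0 < n -> forall d, d <= K -> U d = (l.+1 %| d)) ->
  (exists2 x, x < W ^ n & reach W n K A U tau x) <-> (exists b, schedule l K E tau b).
Proof.
move=> W HA HU.
(* The base [K.+2] exceeds every budget and also exceeds 1 when [K] is 0, so budgets and mask digits
   are both recovered exactly. *)
have digb (b : nat -> bool) v : v < n -> dig W v (enc W n b) = b v.
  by move=> Hv; rewrite dig_enc // => u _; case: (b u).
have digd b t v : v < n -> dig W v (enc W n (budget K b t)) = budget K b t v.
  by move=> Hv; rewrite dig_enc // => u _; rewrite /W !ltnS; apply: leqW; exact: budget_le.
have enclt b t : enc W n (budget K b t) < W ^ n.
  by apply: enc_lt => v _; rewrite /W !ltnS; apply: leqW; exact: budget_le.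
have covE t (b : nat -> bool) : t < tau ->
    covered W n A (t * row_offset n n) (enc W n b) <->
    (forall i j, i < j -> j < n -> edge E t i j -> b i || b j).
  move=> Ht; split=> [H i j Hij Hj|H i j Hi Hj].
    have Hi := ltn_trans Hij Hj; have Hji : j - i.+1 < n - i.+1 by lia.
    have := H _ _ Hi Hji; rewrite HA // subnKC // !digb //.
    by case: (edge _ _ _ _); case: (b i); case: (b j).
  have Hj' : i.+1 + j < n by lia.
  rewrite HA // !digb //; have := H i (i.+1 + j) (leq_addr _ _) Hj'.
  by case: (edge _ _ _ _); case: (b i); case: (b _) => //= /(_ isT).
have moveE b t (c : nat -> bool) :
    move_ok W n U (enc W n c) (enc W n (budget K b t)) <->
    (forall v, v < n -> legal l (budget K b t v) (c v)).
  split=> H v Hv; have := H v Hv; rewrite digb // digd // HU ?budget_le //;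
    try (by apply: leq_ltn_trans Hv); rewrite /legal; case: (c v) => /=; lia.
have subE b t : (forall v, v < n -> legal l (budget K b t v) (b t v)) ->
    enc W n (budget K b t) - enc W n (b t) = enc W n (budget K b t.+1).
  move=> H; rewrite enc_sub // => v Hv; have := H v Hv; rewrite /legal.
  by case: (b t v) => //=.
split=> [[x _]|[b Hb]]; last first.
  exists (enc W n (budget K b tau)) => //.
  have: forall t, t <= tau -> reach W n K A U t (enc W n (budget K b t)); last by apply.
  elim=> [|t IH] Ht //=; have [H1 H2] := Hb t Ht.
  exists (b t), (enc W n (budget K b t)); split=> //.
  - exact/covE.
  - by apply: IH; exact: ltnW.
  - exact/moveE.
  - by rewrite subE.
suff H t y : t <= tau -> reach W n K A U t y ->
    exists2 b, schedule l K E t b & y = enc W n (budget K b t).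
  by move/(H _ _ (leqnn _)) => [b Hb _]; exists b.
elim: t y => [|t IH] y Ht /=; first by move=> ->; exists (fun _ _ => false).
case=> c [x0 [Hx H1 H2 H3 ->]]; have [b Hb Ex] := IH _ (ltnW Ht) H2.
(* The schedule of the first [t] steps is overridden at step [t] alone; budgets up to step [t]
   depend on earlier steps only. *)
pose b' u := if u == t then c else b u.
have Eb u v : u <= t -> budget K b' u v = budget K b u v.
  move=> Hu; apply: eq_budget => t' Ht' z; rewrite /b'.
  by have -> : (t' == t) = false by lia.
have Ebt : b' t = c by rewrite /b' eqxx.
have HL : forall v, v < n -> legal l (budget K b' t v) (b' t v).
  move=> v Hv; rewrite Eb // Ebt; move: v Hv; apply/moveE.
  by rewrite -Ex.
exists b' => [u|].
  rewrite ltnS leq_eqVlt => /orP[/eqP->|Hu].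
    by split=> //; rewrite Ebt; exact/covE.
  have [G1 G2] := Hb u Hu; have Ebu : b' u = b u by rewrite /b' ltn_eqF.
  by rewrite Ebu; split=> // v Hv; rewrite Eb ?G2 // ltnW.
rewrite -subE // Ebt Ex; congr (_ - _); apply: eq_enc => v _.
by rewrite Eb.
Qed.

(** In a budget [d], the quotient by [l.+1] counts the intervals not yet opened and the remainder
    the units left in the running one. This is the effect of opening an interval; the next lemma is
    that of continuing one. *)
Lemma pred_divmod_dvd l d : 0 < d -> l.+1 %| d ->
  (d.-1 %/ l.+1).+1 = d %/ l.+1 /\ d.-1 %% l.+1 = l.
Proof.
move=> Hd /dvdnP[q Eq]; case: q Eq => [|q] Eq; first by rewrite Eq in Hd.
have -> : d.-1 = q * l.+1 + l by rewrite Eq mulSn addSn /= addnC.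
by rewrite divnMDl // modnMDl divn_small // modn_small // addn0 Eq mulnK.
Qed.

Lemma pred_divmod_ndvd l d : ~~ (l.+1 %| d) ->
  d.-1 %/ l.+1 = d %/ l.+1 /\ (d.-1 %% l.+1).+1 = d %% l.+1.
Proof.
rewrite /dvdn => Hr; have := divn_eq d l.+1; have := ltn_pmod d (ltn0Sn l).
set q := d %/ _; set r := d %% _ in Hr *; case: r Hr => // r _ Hr Ed.
have -> : d.-1 = q * l.+1 + r by rewrite Ed addnS.
by rewrite divnMDl // modnMDl divn_small ?modn_small ?addn0 // ltnW.
Qed.

Lemma count_lt (T : eqType) (p q : pred T) (s : seq T) x :
  subpred p q -> x \in s -> q x -> ~~ p x -> count p s < count q s.
Proof.
move=> pq + qx px; elim: s => //= y s IH; rewrite inE => /orP[/eqP<-|/IH H].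
  by rewrite qx (negbTE px) ltnS; exact: sub_count.
by case Ep: (p y); rewrite ?(pq _ Ep) ?ltn_add2l // ltn_addl.
Qed.

(** * From a covering timeline to a schedule *)

Section TimelineToSchedule.
Variables (n k l tau : nat) (E : nat -> 'I_n -> 'I_n -> bool) (T : timeline n).
Hypothesis T_act : @is_k_activity_timeline n k tau T.
Hypothesis T_cov : @covers n tau E T.
Hypothesis T_len : forall x, x \in T -> x.2 - x.1.2 <= l.

Definition covered_at t v :=
  has (fun x : 'I_n * nat * nat => [&& val x.1.1 == v, x.1.2 <= t.+1 & t.+1 <= x.2]) T.

(** The greedy choice and its budget depend on each other. Inlining the choice makes the recursion
    structural; [budget_greedy] then identifies the result with [budget]. *)
Fixpoint greedy_budget t v :=
  if t is t'.+1 then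
    greedy_budget t' v - (~~ (l.+1 %| greedy_budget t' v) || covered_at t' v)
  else k * l.+1.

Definition greedy t v := ~~ (l.+1 %| greedy_budget t v) || covered_at t v.

Lemma budget_greedy t v : budget (k * l.+1) greedy t v = greedy_budget t v.
Proof. by elim: t => //= t ->. Qed.

Definition pending t v :=
  count (fun x : 'I_n * nat * nat => (val x.1.1 == v) && (t <= x.2)) T.

Lemma pending_mono t t' v : t <= t' -> pending t' v <= pending t v.
Proof.
by move=> Htt; apply: sub_count => x /= /andP[-> H]; exact: leq_trans H.
Qed.

(* The block started at step [t] outlives the interval that triggered it. *)
Lemma pending_covered t v : covered_at t v -> pending (t.+2 + l) v < pending t.+1 v.
Proof.
case/hasP=> x xT /and3P[Hv Ha Hb]; rewrite /pending.
apply: (@count_lt _ _ _ _ x) => //.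
- by move=> y /= /andP[-> H]; apply: leq_trans H; rewrite addSn ltnS leqW // leq_addr.
- by rewrite Hv Hb.
- rewrite Hv andTb -ltnNge addSn ltnS -leq_subLR; apply: leq_trans (T_len xT).
  exact: leq_sub2l.
Qed.

(** Step [t] is time [t.+1]. While a block runs, the time grows and the remainder shrinks by one, so
    both sides stay fixed. Opening a block lowers the quotient by one, and by [pending_covered] the
    pending count drops too. While idling, the quotient is fixed and the count cannot grow. *)
Lemma greedy_invariant t v : v < n ->
  pending (t.+1 + greedy_budget t v %% l.+1) v <= greedy_budget t v %/ l.+1.
Proof.
move=> Hv; elim: t => [|t IH].
  rewrite /= mulnK //; have [_ [_ Hc]] := T_act.
  apply: leq_trans (Hc (Ordinal Hv)); apply: sub_count => x /= /andP[/eqP H _].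
  exact/eqP/val_inj.
rewrite /=; set d := greedy_budget t v in IH *.
case: (boolP (l.+1 %| d)) => [Hd|Hd]; last first.
  rewrite orTb subn1; have [-> Hr] := pred_divmod_ndvd Hd.
  by rewrite addSnnS Hr.
have Hd0 : d %% l.+1 = 0 by apply/eqP.
rewrite Hd0 addn0 in IH; rewrite orFb; case: (boolP (covered_at t v)) => Hc.
  have Hp := pending_covered Hc; have d0 : 0 < d.
    by case: (d) IH => // H; rewrite div0n leqn0 in H; rewrite (eqP H) in Hp.
  rewrite subn1; have [Hq ->] := pred_divmod_dvd d0 Hd.
  by rewrite -ltnS Hq; exact: leq_trans IH.
by rewrite subn0 Hd0 addn0; apply: leq_trans IH; exact: pending_mono.
Qed.

Lemma greedy_schedule : @schedule n l (k * l.+1) E tau greedy.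
Proof.
move=> t Ht; split=> [i j Hij Hj Eij|v Hv].
  have Hi := ltn_trans Hij Hj.
  have := @T_cov t.+1 (Ordinal Hi) (Ordinal Hj) Ht.
  rewrite /edge_at Hij /= -edge_ord => /(_ Eij) [x [xT [Hx Hb]]].
  have C w : val x.1.1 = w -> covered_at t w.
    by move=> Ew; apply/hasP; exists x; rewrite // Ew eqxx.
  by apply/orP; case: Hx => Ex; [left|right];
    rewrite /greedy C ?orbT // Ex.
rewrite budget_greedy /greedy; have := greedy_invariant t Hv.
set d := greedy_budget t v; rewrite /legal.
case: (boolP (l.+1 %| d)) => [Hd|Hd] /= IH; last by case: (d) Hd.
case: (boolP (covered_at t v)) => [Hc|//].
(* The interval demanding activity is itself pending, so the quotient is positive and a unit is
   available. *)
have Hp := pending_covered Hc; have Hd0 : d %% l.+1 = 0 by apply/eqP.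
rewrite Hd0 addn0 in IH; case: (d) IH => // H.
by rewrite div0n leqn0 in H; rewrite (eqP H) in Hp.
Qed.

End TimelineToSchedule.

(** * From a schedule to a timeline *)

Section ScheduleToTimeline.
Variables (n k l tau : nat) (E : nat -> 'I_n -> 'I_n -> bool) (b : nat -> nat -> bool).
Hypothesis b_sched : @schedule n l (k * l.+1) E tau b.

Local Notation bud := (budget (k * l.+1) b).

Definition starts v t := b t v && (l.+1 %| bud t v).

(** Cut off at [tau], since a block may be opened fewer than [l] steps before the end of the
    lifetime. *)
Definition block (v : 'I_n) t : 'I_n * nat * nat := (v, t.+1, minn (t.+1 + l) tau).

Definition blocks : timeline n :=
  [seq block v t | v <- enum 'I_n, t <- [seq t <- iota 0 tau | starts v t]].

Lemma mem_blocks x : x \in blocks ->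
  exists (v : 'I_n) t, [/\ t < tau, starts v t & x = block v t].
Proof.
case/allpairsPdep=> v [t [_]]; rewrite mem_filter mem_iota => /andP[Hs /andP[_ Ht]] ->.
by exists v, t.
Qed.

Lemma block_mem (v : 'I_n) t : t < tau -> starts v t -> block v t \in blocks.
Proof.
move=> Ht Hs; apply: allpairs_f_dep; first exact: mem_enum.
by rewrite mem_filter Hs mem_iota.
Qed.

Lemma uniq_blocks : uniq blocks.
Proof.
apply: allpairs_uniq_dep; first exact: enum_uniq.
  by move=> v _; rewrite filter_uniq // iota_uniq.
by move=> [v t] [v' t'] _ _ /= [-> ->].
Qed.

(** A conservation law: the quotient of the budget drops by one at each start and at no other
    step. *)
Lemma count_starts v t : v < n -> t <= tau ->
  count (starts v) (iota 0 t) + bud t v %/ l.+1 = k.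
Proof.
move=> Hv; elim: t => [|t IH] Ht; first by rewrite /= mulnK.
have [_ /(_ v Hv) HL] := b_sched Ht; have := IH (ltnW Ht) => {}IH.
rewrite -addn1 iotaD count_cat /= addn0 add0n addn1 /= -[RHS]IH -addnA; congr (_ + _).
rewrite /starts; move: HL; rewrite /legal; case: (b t v) => [Hd|Hd] /=; last by rewrite subn0.
rewrite subn1; case: (boolP (l.+1 %| _)) => Hdv.
  by have [<- _] := pred_divmod_dvd Hd Hdv.
by have [-> _] := pred_divmod_ndvd Hdv.
Qed.

(** Off the multiples of [l.+1] the vertex cannot have been idle in the preceding step. Going back,
    the remainder grows by one per step until the step that opened the block. *)
Lemma running_block v t : v < n -> t <= tau -> ~~ (l.+1 %| bud t v) ->
  exists2 t0, t0 < t & starts v t0 /\ t0 + l.+1 = t + bud t v %% l.+1.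
Proof.
move=> Hv; elim: t => [|t IH] Ht; first by rewrite /= dvdn_mull.
have [_ /(_ v Hv) HL] := b_sched Ht.
move: HL; rewrite /legal /=; case Eb: (b t v) => Hd; last by rewrite subn0 Hd.
rewrite subn1; case: (boolP (l.+1 %| bud t v)) => Hdv Hn.
  exists t => //; rewrite /starts Eb Hdv; split=> //.
  by have [_ ->] := pred_divmod_dvd Hd Hdv; rewrite addSnnS.
have [t0 H1 [H2 H3]] := IH (ltnW Ht) Hdv; exists t0; first exact: ltnW.
by split=> //; rewrite H3; have [_ <-] := pred_divmod_ndvd Hdv; rewrite addSnnS.
Qed.

Lemma active_in_block v t : v < n -> t < tau -> b t v ->
  exists t0, [/\ t0 <= t, t <= t0 + l & starts v t0].
Proof.
move=> Hv Ht Hb; case: (boolP (l.+1 %| bud t v)) => Hd.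
  by exists t; rewrite leqnn leq_addr /starts Hb Hd.
have [t0 H1 [H2 H3]] := running_block Hv (ltnW Ht) Hd.
exists t0; split=> //; first exact: ltnW.
by move: Hd H3; rewrite /dvdn; case: (_ %% _) => // r _; lia.
Qed.

Lemma timeline_of_schedule : @MinTimelineInf n k l tau E.
Proof.
exists blocks; split; last split.
- split; [exact: uniq_blocks|split].
    move=> x /mem_blocks[v [t [Ht _ ->]]] /=; rewrite leq_min Ht geq_minr.
    by rewrite leq_addr.
  (* The blocks of [v] are distinct and are images of its starts, whose number [count_starts] at
     step [tau] bounds by [k]. *)
  move=> v; rewrite -(count_starts (ltn_ord v) (leqnn tau)).
  apply: leq_trans (leq_addr _ _); rewrite -!size_filter.
  rewrite -(size_map (block v)); apply: uniq_leq_size.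
    by rewrite filter_uniq // uniq_blocks.
  move=> x; rewrite mem_filter => /andP[/eqP Ex /mem_blocks[u [t [Ht Hs Eu]]]].
  rewrite Eu /= in Ex; rewrite Eu Ex; apply: map_f.
  by rewrite mem_filter mem_iota Ht -Ex Hs.
(* Times begin at 1, so time 0 is excluded and time [t.+1] corresponds to step [t]. *)
- move=> [//|t] u v Ht /andP[Huv Euv].
  have [H _] := b_sched Ht; have := H u v Huv (ltn_ord v).
  rewrite edge_ord => /(_ Euv) Hb.
  have cov (w : 'I_n) : b t w -> exists x, x \in blocks /\ x.1.1 = w /\ x.1.2 <= t.+1 <= x.2.
    case/(active_in_block (ltn_ord w) Ht) => t0 [H1 H2 Hs].
    exists (block w t0); split; first by apply: block_mem => //; exact: leq_ltn_trans H1 _.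
    by split=> //=; rewrite ltnS H1 leq_min addSn ltnS H2.
  by case/orP: Hb => /cov[x [H1 [H2 H3]]]; exists x; split=> //; split=> //; [left|right].
- move=> x /mem_blocks[v [t [Ht _ ->]]] /=.
  by rewrite leq_subLR geq_minl.
Qed.

End ScheduleToTimeline.

(** The factor [(0 < n)] comes from the program, which computes budget 0 on the empty vertex set; as
    soon as there is a vertex it equals 1. *)
Lemma schedule_MinTimeline n k l tau (E : nat -> 'I_n -> 'I_n -> bool) :
  (exists b, schedule l ((0 < n) * (k * l.+1)) E tau b) <-> @MinTimelineInf n k l tau E.
Proof.
have HK v b t : v < n -> budget ((0 < n) * (k * l.+1)) b t v = budget (k * l.+1) b t v.
  by move=> Hv; rewrite (leq_ltn_trans _ Hv) // mul1n.
split=> [[b Hb]|[T [H1 [H2 H3]]]].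
  apply: (@timeline_of_schedule _ _ _ _ _ b) => t Ht; have [G1 G2] := Hb t Ht.
  by split=> // v Hv; rewrite -HK //; exact: G2.
exists (greedy k l T) => t Ht.
have [G1 G2] := greedy_schedule H1 H2 H3 Ht.
by split=> // v Hv; rewrite HK //; exact: G2.
Qed.

(** * The complete machine program and its time bound *)

Definition program :=
  prologue ++ (compile prog_main 105 ++ [:: IConst 0 0; IAdd 0 0 28; IHalt]).

(** Here [X] stands for (k+1)^n (l+2)^n, [Y] for 2^n, [kk] for [(0 < n) * k], [W] for the base and
    [N] for its [n]-th power. After expansion each monomial is at most [Z], factor by factor, so
    only the sum of the coefficients has to be compared with 2000. The factor [tau.+1] accounts for
    the work done even when [tau = 0]. *)
Lemma step_bound n tau kk W N X Y :
  kk <= X -> n * W <= n * X -> N <= X -> 0 < X -> 0 < Y ->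
  128 * (tau * (n * n) + 4) +
  (100 + (kk * 12 + 20) + n * (24 + Y * 21 + W * 5) + N * 40 +
   tau * (20 + Y * (40 + n * (30 + n * 30) + N * (50 + n * 45)))) + 2 <=
  2000 * (X * Y * tau.+1 * n.+1 ^ 2).
Proof.
move=> Hk HW HN X0 Y0; set Z := X * Y * tau.+1 * n.+1 ^ 2.
have Q : n.+1 ^ 2 = n * n + 2 * n + 1 by rewrite expnS expn1; lia.
have H a b c d : a <= X -> b <= Y -> c <= tau.+1 -> d <= n.+1 ^ 2 -> a * b * c * d <= Z.
  by move=> *; rewrite /Z !leq_mul.
have q0 : 1 <= n.+1 ^ 2 by lia.
have q1 : n <= n.+1 ^ 2 by lia.
have q2 : n * n <= n.+1 ^ 2 by lia.
have c0 : 1 <= tau.+1 by [].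
have c1 : tau <= tau.+1 by [].
have := H kk 1 1 1 Hk Y0 c0 q0; have := H 1 1 1 1 X0 Y0 c0 q0.
have := H 1 1 1 n X0 Y0 c0 q1; have := H 1 Y 1 n X0 (leqnn _) c0 q1.
have := H X 1 1 n (leqnn _) Y0 c0 q1; have := H N 1 1 1 HN Y0 c0 q0.
have := H 1 1 tau (n * n) X0 Y0 c1 q2; have := H 1 1 tau 1 X0 Y0 c1 q0.
have := H 1 Y tau 1 X0 (leqnn _) c1 q0; have := H 1 Y tau n X0 (leqnn _) c1 q1.
have := H 1 Y tau (n * n) X0 (leqnn _) c1 q2.
have := H N Y tau 1 HN (leqnn _) c1 q0; have := H N Y tau n HN (leqnn _) c1 q1.
rewrite !mul1n !muln1; clear H Q q0 q1 q2 c0 c1; clearbody Z.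
by lia.
Qed.

(** Register 0 is cleared before the result is added to it, so the source must be another register,
    whence the index [r.+1]. *)
Lemma run_output P o r m : code_at P o [:: IConst 0 0; IAdd 0 0 r.+1; IHalt] ->
  [/\ runs P 2 (o, m) (o.+2, upd (upd m 0 0) 0 (m r.+1)) & nth IHalt P o.+2 = IHalt].
Proof.
move=> H; have := H 0 isT; have := H 1 isT; have := H 2 isT.
by rewrite addn0 addn1 addn2 /= => E2 E1 E0; rewrite E0 /= E1.
Qed.

Theorem mainTheorem6 :
  exists (P : seq instr) (C c : nat),
    forall (n k l tau : nat) (E : nat -> 'I_n -> 'I_n -> bool),
      exists m : memory,
        halts_in P (C * (k.+1) ^ n * (l.+2) ^ n * 2 ^ n * tau.+1 * (n.+1) ^ c)
          (init (@encode n k l tau E)) = Some m /\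
        (m 0 = 0 \/ m 0 = 1) /\
        (m 0 = 1 <-> @MinTimelineInf n k l tau E).
Proof.
exists program, 2000, 2 => n k l tau E.
have Hpro : code_at program 0 prologue by exact: (@code_at_self [::]).
have Hmain : code_at program 105 (compile prog_main 105) by exact: code_at_self.
have Hend : code_at program (105 + clen prog_main) [:: IConst 0 0; IAdd 0 0 28; IHalt].
  have := @code_at_self (prologue ++ compile prog_main 105) [:: IConst 0 0; IAdd 0 0 28; IHalt] [::].
  by rewrite cats0 size_cat size_compile -catA.
have [t1 [m1 [B [R1 [Ht1 [s S1 [[hn hk hl htau] [hE hA]]]]]]]] :=
  prologue_correct n k l tau (edge_bits tau E) Hpro.
have [Hc [Hres [U HU HP]]] := main_ht hn hk hl htau hA.
set T0 := (X in cost prog_main s <= X) in Hc.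
have [m2 R2 S2] := compile_correct wf_main Hmain S1.
have [R3 E2] := run_output m2 Hend.
set m3 := upd _ 0 _ in R3.
exists m3; split.
  apply: (runs_halts (runs_trans R1 (runs_trans R2 R3)) E2).
  have Hs : t1 <= 128 * (tau * (n * n) + 4).
    by move: Ht1 (size_edge_bits tau E); clear; lia.
  have X0 : 0 < k.+1 ^ n * l.+2 ^ n by rewrite muln_gt0 !expn_gt0.
  have Y0 : 0 < 2 ^ n by rewrite expn_gt0.
  have HW : ((0 < n) * (k * l.+1)).+2 <= k.+1 * l.+2 by case: (0 < n); nia.
  have HN : ((0 < n) * (k * l.+1)).+2 ^ n <= k.+1 ^ n * l.+2 ^ n.
    by rewrite -expnMn; case: (n) HW => // n' HW; rewrite leq_exp2r.
  (* For [n = 0] the left side is 0; otherwise one factor of the power already exceeds [k]. *)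
  have Hk : (0 < n) * k <= k.+1 ^ n * l.+2 ^ n.
    case: (n) => // n'; rewrite mul1n -expnMn expnS; apply: leq_trans (leq_pmulr _ _).
      by nia.
    by rewrite expn_gt0 muln_gt0.
  have HnW : n * ((0 < n) * (k * l.+1)).+2 <= n * (k.+1 ^ n * l.+2 ^ n).
    case: (n) HW => // n' HW; rewrite leq_pmul2l // -expnMn expnS.
    by apply: leq_trans HW (leq_pmulr _ _); rewrite expn_gt0 muln_gt0.
  have HB := @step_bound n tau _ _ _ _ _ Hk HnW HN X0 Y0.
  apply: leq_trans (leq_trans _ HB) _; last by rewrite !mulnA.
  rewrite addnA leq_add2r leq_add //; apply: leq_trans Hc _; rewrite /T0.
  do 3 apply: leq_add => //; rewrite leq_add2l mulnDr.
  by case: (0 < n); rewrite ?mul1n ?mul0n.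
have -> : m3 0 = vr (eval prog_main s) 28 by rewrite -(sim_var S2).
 split; first by move: Hres; lia.
apply: (iff_trans HP); apply: (iff_trans _ (schedule_MinTimeline k l tau E)).
apply: (@reach_schedule n l ((0 < n) * (k * l.+1)) E tau (ar s 0) U _ HU).
by move=> t i j Ht Hi Hj; rewrite hE nth_edge_bits.
Qed.
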